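(* For every $L>0$, $\alpha>0$, $K>0$ and $\beta\in(0,1]$ there are constants $c_1,c_2,C_1,C_2>0$ depending only on $\alpha,\beta,K$ and $L$ such that the following holds. Let $X$ be a centered, strongly square integrable random variable with values in $\mathcal{H}$, with covariance operator $\Sigma$ having eigenvalues $\lambda_1\geq\lambda_2\geq\dots>0$ and orthonormal basis of eigenvectors $u_1,u_2,\dots$. Suppose that the Karhunen--Loève coefficients $\eta_j=\lambda_j^{-1/2}\langle X,u_j\rangle$, $j\geq 1$, are independent and satisfy $\sup_{j\geq 1}\sup_{q\geq 1}q^{-1/2}(\mathbb{E}|\eta_j|^q)^{1/q}\leq L$. Suppose moreover that $K^{-1}\exp(-\alpha j^\beta)\leq\lambda_j\leq K\exp(-\alpha j^\beta)$ for all $j\geq 1$. Let $X_1,\dots,X_n$ be independent copies of $X$, and let $\hat P_{\leq d}$ be the empirical PCA projection of rank $d$. Then, for all natural numbers $1\leq d\leq c_1n$, with probability at least $1-\exp(-c_2n)$, $$R(\hat P_{\leq d})\leq C_1d^{1-\beta}\exp(-\alpha(d+1)^\beta)\leq C_2\min_{P\in\mathcal{P}_d}R(P).$$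
   Context: $\mathcal{H}$ is a real (separable, infinite-dimensional) Hilbert space with inner product $\langle\cdot,\cdot\rangle$ and norm $\|\cdot\|$. $X$ is an $\mathcal{H}$-valued random variable, centered ($\mathbb{E}X=0$) and strongly square integrable ($\mathbb{E}\|X\|^2<\infty$). For $u,v,x\in\mathcal{H}$, $(u\otimes v)x=\langle v,x\rangle u$. The covariance operator $\Sigma=\mathbb{E}\,X\otimes X$ has positive summable eigenvalues $\lambda_1\geq\lambda_2\geq\dots>0$ (with multiplicity) and corresponding eigenvectors $u_1,u_2,\dots$ assumed to form an orthonormal basis of $\mathcal{H}$, so $\Sigma=\sum_{j\geq1}\lambda_j\,u_j\otimes u_j$. $\mathcal{P}_d$ is the class of orthogonal projections on $\mathcal{H}$ of rank $d$. The reconstruction error of an orthogonal projection $P$ is $R(P)=\mathbb{E}\|X-PX\|^2=\mathrm{tr}(\Sigma(I-P))$, the expectation being over $X$ for fixed $P$; $R(\hat P)$ for a data-dependent $\hat P$ is the random variable obtained by plugging $\hat P$ into $R$, i.e. $\mathrm{tr}(\Sigma(I-\hat P))$. Given independent copies $X_1,\dots,X_n$ of $X$ ($n\geq 1$), the sample covariance is $\hat\Sigma=n^{-1}\sum_{i=1}^nX_i\otimes X_i$, with eigenvalues $\hat\lambda_1\geq\hat\lambda_2\geq\dots\geq0$ and an orthonormal basis of eigenvectors $\hat u_1,\hat u_2,\dots$. The empirical PCA projection is $\hat P_{\leq d}=\sum_{j\leq d}\hat u_j\otimes\hat u_j$, a minimizer over $\mathcal{P}_d$ of the empirical reconstruction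 error $R_n(P)=n^{-1}\sum_{i=1}^n\|X_i-PX_i\|^2$. *)

(* Defs.v *)
(* MathComp-Analysis *)
From mathcomp Require Export all_boot all_order all_algebra.
From mathcomp Require Export all_classical all_reals all_analysis.

Export Order.TTheory GRing.Theory Num.Theory numFieldNormedType.Exports.

#[export] Set Implicit Arguments.
#[export] Unset Strict Implicit.
#[export] Unset Printing Implicit Defensive.

Local Open Scope classical_set_scope.
Local Open Scope ring_scope.

Notation borel_of V := (g_sigma_algebraType (@open V)).

(* A complete normed space whose norm comes from [ip] is a real Hilbert space;
   positive definiteness of [ip] is that of the norm. *)
Definition is_inner_product (R : realType) (H : completeNormedModType R)
    (ip : H -> H -> R) : Prop :=
  [/\ forall x y, ip x y = ip y x,
      forall a x y z, ip (a *: x + y) z = a * ip x z + ip y z &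
      forall x, ip x x = `|x| ^+ 2].

Section hilbert.
Context {R : realType} {H : completeNormedModType R}.
Variable ip : H -> H -> R.

Definition tensor (u v x : H) : H := ip v x *: u.

(* The existence of such a sequence makes [H] separable and
   infinite-dimensional. *)
Definition orthonormal_basis (u : nat -> H) : Prop :=
  (forall i j, ip (u i) (u j) = (i == j)%:R) /\
  (forall x, series (fun j => ip (u j) x *: u j) @ \oo --> x).

Definition finite_rank (T : H -> H) (d : nat) : Prop :=
  exists b : 'I_d -> H,
    (forall c : 'I_d -> R, \sum_i c i *: b i = 0 -> forall i, c i = 0) /\
    range T = [set x | exists c : 'I_d -> R, x = \sum_i c i *: b i].

Definition orthogonal_projections (d : nat) : set (H -> H) :=
  [set T | [/\ forall a x y, T (a *: x + y) = a *: T x + T y,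
               forall x, T (T x) = T x,
               forall x y, ip (T x) y = ip x (T y) &
               finite_rank T d]].

(* Eigenvalue and eigenvector sequences are indexed from 0: [l j] is the
   (j+1)-st largest eigenvalue, with multiplicity. *)
Definition spectral_decomposition (T : H -> H) (l : nat -> R) (u : nat -> H)
    : Prop :=
  [/\ nonincreasing_seq l, orthonormal_basis u &
      forall j, T (u j) = l j *: u j].

Definition spectral_projection (u : nat -> H) (d : nat) (x : H) : H :=
  \sum_(j < d) tensor (u j) (u j) x.

Definition sample_covariance (n : nat) (x : 'I_n -> H) (y : H) : H :=
  n%:R^-1 *: \sum_i tensor (x i) (x i) y.

Section random_vector.
Context {d0 : measure_display} {T : measurableType d0}.
Variables (P : probability T R) (X : T -> H).

Definition strongly_square_integrable : Prop :=
  ('E_P[fun w => (`|X w| ^+ 2)%R] < +oo)%E.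

(* Expectations of random vectors and operators are taken in the weak sense,
   which agrees with the Bochner integral for strongly square integrable X. *)
Definition centered : Prop := forall v, ('E_P[fun w => ip (X w) v] = 0)%E.

Definition is_covariance (Sigma : H -> H) : Prop :=
  forall u v, ('E_P[fun w => ip (tensor (X w) (X w) u) v]
               = (ip (Sigma u) v)%:E)%E.

Definition reconstruction_error (Q : H -> H) : \bar R :=
  ('E_P[fun w => (`|X w - Q (X w)| ^+ 2)%R])%E.

Definition KL_coefficient (l : nat -> R) (u : nat -> H) (j : nat) (w : T) : R :=
  (Num.sqrt (l j))^-1 * ip (X w) (u j).

End random_vector.
End hilbert.

Section probability_notions.
Context {R : realType} {d0 : measure_display} {T : measurableType d0}.
Variable P : probability T R.

Definition independent_family (I : eqType) (d1 : measure_display)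
    (V : measurableType d1) (f : I -> T -> V) : Prop :=
  forall (J : seq I) (B : I -> set V), uniq J ->
    (forall i, i \in J -> measurable (B i)) ->
    (P (\bigcap_(i in [set` J]) (f i @^-1` B i))
     = \prod_(i <- J) P (f i @^-1` B i))%E.

Definition psi2_norm (f : T -> R) : \bar R :=
  ereal_sup [set ((Num.sqrt q)^-1%:E * 'N[P]_(q%:E)[EFin \o f])%E
            | q in [set q : R | 1 <= q]].

(* No measurability of [E] is presupposed: [E] must contain a measurable event
   of probability at least [p]; for measurable [E] this says p <= P(E). *)
Definition with_probability_at_least (p : R) (E : set T) : Prop :=
  exists A, [/\ measurable A, A `<=` E & (p%:E <= P A)%E].

End probability_notions.

Definition same_distribution (R : realType) (d1 d2 d : measure_display)
    (T1 : measurableType d1) (T2 : measurableType d2) (V : measurableType d)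
    (P1 : probability T1 R) (P2 : probability T2 R)
    (f1 : T1 -> V) (f2 : T2 -> V) : Prop :=
  forall B, measurable B -> P1 (f1 @^-1` B) = P2 (f2 @^-1` B).

Definition is_minimum (R : realType) (S : set (\bar R)) (m : \bar R) : Prop :=
  S m /\ lbound S m.

(* Main.v *)
Require Import Defs.
From mathcomp Require Import ring lra zify measurable_realfun.

(** Fix [k], let [Pk] be the projection onto the first [k] eigenvectors of
    [Sigma], let [Q] be the empirical projection, and let [tau] be the order of
    the sum of the eigenvalues [lambda j], [j >= k].

    The oracle.  By Ky Fan's inequality the minimal risk is attained at [Pk]
    ([risk_minimizer]), where it is the sum of the eigenvalues beyond the [k]-th
    ([risk_tail_le], [risk_tail_ge]).  For eigenvalues of order
    [exp (- alpha j^beta)] this sum is of order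
    [k^(1 - beta) exp (- alpha (k + 1)^beta)], from above
    ([stretched_exp_tail_le]) and from below ([stretched_exp_tail_ge]).  So the
    risk of [Q] has to be bounded by a multiple of [tau].

    Reduction to the sample.  Splitting [X] into [Pk X] and its residual, the
    risk of [Q] is at most [2 tau + 2 E |Pk X - Q Pk X|^2] ([risk_le_excess]).
    Suppose that the sample second moment matrix of the first [k]
    Karhunen-Loeve coefficients is at least [1/4] times the identity.  Then
    [E |Pk X - Q Pk X|^2] is at most [4] times the same quantity for the sample,
    and the latter is controlled by the empirical risks of [Q] and of [Pk].  As
    [Q] minimizes the empirical risk, that of [Pk] suffices ([excess_risk_le]).

    Two probabilistic facts remain, both with exponentially small exceptional
    probability ([good_sample]).  First, the empirical risk of [Pk] is at most a
    multiple of [tau]: divided by [tau], the squared residual is a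
    combination of squared coefficients with weights of total mass at most one,
    so it has a bounded exponential moment ([expR_tail]) and Chernoff's bound
    applies.  Secondly, the matrix has the
    stated lower bound.  In a fixed direction the square is nonnegative, with
    mean one and bounded second moment, so its average rarely drops below [1/2]
    ([expR_direction_sq], [direction_event_le]).  A union bound over a grid of
    mesh of order [k^(-1/2)] extends this to all directions: rounding costs the
    squared mesh times the trace of the matrix ([quadratic_form_rounding]), the
    trace is at most a multiple of [k] for the same reason as above
    ([expR_head]), and the grid has exponentially many points in [k]
    ([grid_weight]), which is affordable as long as [k <= c1 n]. *)

Local Open Scope classical_set_scope.
Local Open Scope ring_scope.

(** * Elementary exponential inequalities *)

Lemma expR1_ge2 (R : realType) : 2 <= expR 1 :> R.
Proof. by have := expR_ge1Dx (1 : R); lra. Qed.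

(** Integrating against a centered variable kills the linear term, so that a
    bound on [E exp (c f^2)] becomes a bound on the moment generating function
    of [f].  For [x <= 1/2] it follows from [exp (- x) >= 1 - x]; beyond [1/2]
    already [x <= 2 x^2]. *)
Lemma expR_le_add_sq (R : realType) (x : R) : expR x <= x + expR (2 * x ^+ 2).
Proof.
have [x_le|x_gt] := lerP x 2^-1.
  apply: (@le_trans _ _ (x + (1 + 2 * x ^+ 2))); last first.
    by rewrite lerD2l expR_ge1Dx.
  have h1 : 0 < 1 - x by lra.
  have : expR x <= (1 - x)^-1.
    rewrite -[x in expR x]opprK expRN lef_pV2 ?posrE ?expR_gt0 //.
    exact: expR_ge1Dx.
  move=> /le_trans; apply.
  rewrite -[_^-1]mul1r ler_pdivrMr //.
  nra.
apply: le_trans (_ : expR (2 * x ^+ 2) <= _); last by lra.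
rewrite ler_expR; nra.
Qed.

(** The second-order bound behind lower tails: a nonnegative variable with mean
    one and finite second moment is rarely small on average. *)
Lemma expRN_le_quad (R : realType) (y : R) : 0 <= y -> expR (- y) + y <= 1 + y ^+ 2.
Proof.
move=> y0; have h1 : 0 < 1 + y by lra.
have : expR (- y) <= (1 + y)^-1.
  by rewrite expRN lef_pV2 ?posrE ?expR_gt0 // expR_ge1Dx.
move=> h; rewrite -lerBrDr; apply: le_trans h _.
rewrite -[_^-1]mul1r ler_pdivrMr //; nra.
Qed.

Lemma fourth_power_le_expR (R : realType) (x : R) : x ^+ 4 <=
    24 * (expR x + expR (- x)).
Proof.
wlog x0 : x / 0 <= x.
  move=> h; case: (lerP 0 x) => [/h //|x0].
  have := h (- x); rewrite opprK => /(_ _); rewrite addrC.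
  have -> : (- x) ^+ 4 = x ^+ 4 by ring.
  by apply; lra.
have := @expR_ge1Dxn R x 3 x0.
have -> : (4`!%:R : R) = 24 by rewrite !factS fact0.
have := expR_ge0 (-x). lra.
Qed.

(** Convexity on the segment from [0] to [x]: lowering an exponent by a factor
    [t] leaves an excess over one that is linear in [t]. *)
Lemma expR_chord (R : realType) (t x : R) : 0 <= t <= 1 ->
  expR (t * x) <= 1 + t * (expR x - 1).
Proof.
move=> /andP[t0 t1].
have h1 := expR_ge1Dx (x - t * x).
have h2 := expR_ge1Dx (- (t * x)).
have e0 := expR_gt0 (t * x).
have e1 : expR x = expR (t * x) * expR (x - t * x) by rewrite -expRD; congr expR; ring.
have e2 : 1 = expR (t * x) * expR (- (t * x)) by rewrite -expRD subrr expR0.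
have h3 : expR (t * x) * (t * (1 + (x - t*x)) + (1 - t) * (1 + - (t * x))) <=
  t * expR x + (1 - t).
  have -> : t * expR x + (1 - t) =
      expR (t * x) * (t * expR (x - t * x) + (1-t) * expR (- (t * x))).
    rewrite mulrDr mulrCA -e1 mulrCA -e2; ring.
  rewrite ler_pM2l //; apply: lerD; apply: ler_wpM2l => //; lra.
have -> : 1 + t * (expR x - 1) = t * expR x + (1 - t) by ring.
apply: le_trans h3; rewrite -[leLHS]mulr1 ler_pM2l //.
nra.
Qed.

(** Jensen's inequality for weights of total mass at most one, the missing mass
    sitting at [0].  It is the sum of the tangent-line bounds at the mean. *)
Lemma expR_subconvex (R : realType) (I : Type) (r : seq I) (w y : I -> R) :
  (forall i, 0 <= w i) -> \sum_(i <- r) w i <= 1 ->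
  expR (\sum_(i <- r) w i * y i) <= 1 - \sum_(i <- r) w i +
      \sum_(i <- r) w i * expR (y i).
Proof.
move=> w0 w1; set c := \sum_(i <- r) w i * y i; set W := \sum_(i <- r) w i.
have tan z : expR c * (1 + (z - c)) <= expR z.
  have {2}-> : z = c + (z - c) by ring.
  by rewrite expRD ler_pM2l ?expR_gt0 // expR_ge1Dx.
have h : expR c * (\sum_(i <- r) w i * (1 + (y i - c))) <=
    \sum_(i <- r) w i * expR (y i).
  rewrite mulr_sumr; apply: ler_sum => i _.
  by rewrite mulrCA ler_wpM2l.
have e : \sum_(i <- r) w i * (1 + (y i - c)) = W + c - W * c.
  rewrite (eq_bigr (fun i => w i + w i * y i - w i * c)); last by move=> i _; ring.
  by rewrite !big_split /= -/W -/c sumrN -mulr_suml -/W.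
rewrite e in h.
have h0 := tan 0; rewrite expR0 in h0.
have : (1 - W) * (expR c * (1 + (0 - c))) <= (1 - W) * 1 by apply: ler_wpM2l => //;
    rewrite subr_ge0.
have := expR_gt0 c; nra.
Qed.

Lemma expnn_le_fact (R : realType) (k : nat) : (k%:R : R) ^+ k <= expR 1 ^+ k * k`!%:R.
Proof.
case: k => [|k]; first by rewrite !expr0 mul1r fact0.
rewrite -expRM_natl mulr1 -ler_pdivrMr; last by rewrite ltr0n fact_gt0.
by have := @expR_ge1Dxn R k.+1%:R k (ler0n _ _); lra.
Qed.

(** * Tails of stretched exponentials *)

(** As [g <= 1], the factor [(1 + x/a)^g] is at most [1 + x/a]. *)
Lemma powR_add_le (R : realType) (a x g : R) : 0 < a -> 0 <= x -> g <= 1 ->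
  (a + x) `^ g <= a `^ g * (1 + x / a).
Proof.
move=> a0 x0 g1; have -> : a + x = a * (1 + x / a) by field; lra.
have h : 1 <= 1 + x / a by rewrite lerDl divr_ge0 // ltW.
rewrite powRM; [|lra|lra].
by rewrite ler_wpM2l ?powR_ge0 // ler1_powR.
Qed.

(** With [h = 1/x], [(1 - h)^b <= exp (- b h) <= 1 / (1 + b h)]. *)
Lemma powR_sub1_le (R : realType) (x b : R) : 1 <= x -> 0 < b ->
  b / (1 + b) * x `^ (b - 1) <= x `^ b - (x - 1) `^ b.
Proof.
move=> x1 b0; have x0 : 0 < x by lra.
have -> : (x - 1) = x * (1 - x^-1) by field; lra.
have xi : x^-1 <= 1 by rewrite invf_le1.
have xi0 : 0 < x^-1 by rewrite invr_gt0.
rewrite powRM; [|lra|lra].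
rewrite -(mulr_powRB1 (ltW x0) b0).
have p0 : 0 < x `^ (b - 1) by rewrite powR_gt0.
have h1 : (1 - x^-1) `^ b <= expR (- (b * x^-1)).
  rewrite -mulrN mulrC expRM; apply: ge0_ler_powR; rewrite ?nnegrE ?expR_ge0; try lra.
  exact: expR_ge1Dx.
have h2 : expR (- (b * x^-1)) <= (1 + b * x^-1)^-1.
  by rewrite expRN lef_pV2 ?posrE ?expR_gt0 ?expR_ge1Dx //; nra.
have h3 : (1 - x^-1) `^ b <= 1 - x^-1 * (b / (1 + b)).
  apply: le_trans h1 _; apply: le_trans h2 _.
  have d0 : 0 < 1 + b * x^-1 by nra.
  have d1 : 0 < 1 + b by lra.
  have -> : (1 + b / x)^-1 = 1 - x^-1 * (b / (1 + b / x)) by field;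
      rewrite !gt_eqF //=; nra.
  rewrite lerD2l lerN2 ler_pM2l // ler_pM2l // lef_pV2 ?posrE //; nra.
set w := (1 - x^-1) `^ b in h3 *.
have -> : x * x `^ (b-1) - x * x `^ (b - 1) * w = x `^ (b-1) * (x * (1 - w)) by ring.
rewrite mulrC ler_pM2l //.
have -> : b / (1 + b) = x * (x^-1 * (b / (1 + b))) by field; lra.
rewrite ler_pM2l //; lra.
Qed.

(** Telescoping with the potential
    [g m = D (m + B)^(1 - b) exp (- a m^b)]: the exponential factor loses a
    proportion of order [m^(b - 1)] at each step, hence [g m - g (m + 1)] is at
    least [exp (- a m^b)], provided that the power [(m + B)^(1 - b)] grows
    slowly enough.  A large shift [B] ensures this for all [m >= 1] at once. *)
Lemma stretched_exp_tail_le (R : realType) (a b : R) : 0 < a -> 0 < b <= 1 ->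
  exists2 C : R, 0 < C & forall k N : nat, (1 <= k)%N ->
   \sum_(k <= j < N) expR (- a * j.+1%:R `^ b) <=
      C * k%:R `^ (1 - b) * expR (- a * k.+1%:R `^ b).
Proof.
move=> a0 /andP[b0 b1].
pose y := a * (b / (1 + b)).
have y0 : 0 < y by rewrite /y mulr_gt0 // divr_gt0 //; lra.
pose th := y / (1 + y).
have th0 : 0 < th by rewrite /th divr_gt0 //; lra.
have thp : 0 < 2 / th by rewrite divr_gt0.
(* This shift makes the increments of (m + B)^(1 - b) at most th / 2. *)
pose B := (2 / th) `^ (b^-1).
have B0 : 0 < B by rewrite powR_gt0 // divr_gt0.
have BE : B `^ (- b) = th / 2.
  by rewrite /B -powRrM mulrN mulVf ?gt_eqF // powR_inv1 ?divr_ge0 ?invf_div //; lra.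
have [D [D0 Dth]] : exists D : R, 0 < D /\ D * th / 2 = 1.
  by exists (2 / th); split; [rewrite divr_gt0 | field; lra].
pose g (m : nat) := D * (m%:R + B) `^ (1 - b) * expR (- a * m%:R `^ b).
have g0 m : 0 <= g m.
  apply: mulr_ge0; last exact: expR_ge0.
  by apply: mulr_ge0; [exact: ltW | exact: powR_ge0].
have key m : expR (- a * m.+1%:R `^ b) <= g m.+1 - g m.+2.
  rewrite /g; set E := expR (- a * m.+1%:R `^ b).
  have E0 : 0 < E by exact: expR_gt0.
  pose x : R := m.+2%:R.
  have x1 : 1 <= x by rewrite /x ler1n.
  have xm : m.+1%:R = x - 1 :> R by rewrite /x -[in RHS]natr1; ring.
  have := powR_sub1_le x1 b0; rewrite -xm => h.
  pose s := (x + B) `^ (1 - b).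
  have s1 : 1 <= s.
    rewrite /s -[leLHS](powRr0 (x + B)); apply: ler_powR; lra.
  have hs : s^-1 <= x `^ (b - 1).
    have -> : b - 1 = - (1 - b) by ring.
    rewrite powRN.
    rewrite lef_pV2 ?posrE ?powR_gt0 //; try lra.
    by apply: ge0_ler_powR; rewrite ?nnegrE; lra.
  have hE : expR (- a * x `^ b) <= E * (1 + y * s^-1)^-1.
    have -> : - a * x `^ b = - a * m.+1%:R `^ b +
        - (a * (x `^ b - m.+1%:R `^ b)) by ring.
    rewrite expRD -/E ler_pM2l // expRN lef_pV2 ?posrE ?expR_gt0 //; last first.
      have ys : 0 < y / s by apply: divr_gt0 => //; lra.
      lra.
    apply: le_trans (expR_ge1Dx _); rewrite lerD2l /y -mulrA ler_pM2l //.
    apply: le_trans h; rewrite ler_pM2l // divr_gt0 //; lra.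
  have hm : s - th / 2 <= (m.+1%:R + B) `^ (1 - b).
    have mB : 0 < m.+1%:R + B by rewrite addr_gt0.
    have := @powR_add_le R (m.+1%:R + B) 1 (1 - b) mB ler01.
    have -> : m.+1%:R + B + 1 = x + B by rewrite xm; ring.
    move=> /(_ ltac:(lra)); rewrite -/s mulrDr mulr1 mul1r => hh.
    rewrite lerBlDr; apply: le_trans hh _; rewrite lerD2l.
    rewrite -BE -[X in _ * X]powR_inv1 ?(ltW mB) // -powRD;
        last by rewrite (gt_eqF mB) implybT.
    have -> : 1 - b + -1 = - b by ring.
    rewrite !powRN lef_pV2 ?posrE ?powR_gt0 ?thp //.
    by apply: ge0_ler_powR; rewrite ?nnegrE ?(ltW mB) ?(ltW b0) ?(ltW B0) // lerDr.
  have s0 : 0 < s by lra.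
  have hy : s * (1 + y * s^-1)^-1 <= s - th.
    have -> : s * (1 + y / s)^-1 = s - y * (s / (s + y)) by field; lra.
    rewrite lerD2l lerN2 /th ler_pM2l // ler_pdivlMr; last lra.
    rewrite mulrC ler_pdivrMr; last lra. nra.
  have hs2 : D * s * expR (- a * x `^ b) <= D * E * (s - th).
    rewrite -!mulrA ler_pM2l //.
    apply: le_trans (_ : s * (E * (1 + y / s)^-1) <= _); first by rewrite ler_pM2l.
    by rewrite mulrCA ler_pM2l.
  apply: le_trans (_ : D * (s - th/2) * E - D * E * (s - th) <= _); last first.
    apply: lerB; last exact: hs2.
    by rewrite (ler_pM2r E0) (ler_pM2l D0).
  have -> : D * (s - th / 2) * E - D * E * (s - th) = (D * th / 2) * E by field.
  by rewrite Dth mul1r.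
have tel k N : \sum_(k <= j < N) expR (- a * j.+1%:R `^ b) <= g k.+1.
  case: (leqP k N) => kN; last by rewrite big_geq ?g0 // ltnW.
  apply: (@le_trans _ _ (\sum_(k <= j < N) - (g j.+2 - g j.+1))).
    by apply: ler_sum => j _; rewrite opprB.
  rewrite sumrN (telescope_sumr (fun j => g j.+1)) // opprB.
  by have := g0 N.+1; lra.
exists (D * (2 + B) `^ (1 - b)); first by rewrite mulr_gt0 // powR_gt0; lra.
move=> k N k1; apply: le_trans (tel k N) _.
rewrite /g ler_pM2r ?expR_gt0 // -mulrA ler_pM2l // -powRM ?ler0n //; last lra.
have k1' : 1 <= k%:R :> R by rewrite ler1n.
apply: ge0_ler_powR; rewrite ?nnegrE; rewrite -?natr1; nra.
Qed.

(** About [k^(1 - b)] terms are comparable with the first one, because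
    [(k + 1 + i)^b] exceeds [(k + 1)^b] by at most [1] when [i <= k^(1 - b)]. *)
Lemma stretched_exp_tail_ge (R : realType) (a b : R) : 0 < a -> 0 < b <= 1 ->
  forall k : nat, (1 <= k)%N -> exists N,
   expR (- a) * k%:R `^ (1 - b) * expR (- a * k.+1%:R `^ b) <=
   \sum_(k <= j < N) expR (- a * j.+1%:R `^ b).
Proof.
move=> a0 /andP[b0 b1] k k1.
pose s : R := k%:R `^ (1 - b).
have s0 : 0 <= s by rewrite powR_ge0.
pose J := Num.truncn s.
have /andP[Js sJ] := truncn_itv s0.
exists (k + J.+1)%N.
have -> : \sum_(k <= j < k + J.+1) expR (- a * j.+1%:R `^ b) =
  \sum_(0 <= i < J.+1) expR (- a * (i + k).+1%:R `^ b).
  by rewrite -{1}[k]add0n big_addn addKn.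
apply: le_trans (_ : \sum_(0 <= i < J.+1) expR (- a) * expR (- a * k.+1%:R `^ b) <= _).
  rewrite sumr_const_nat subn0 -[leRHS]mulr_natl.
  rewrite -mulrA mulrCA ler_pM2r; first exact: ltW.
  by rewrite mulr_gt0 ?expR_gt0.
rewrite !big_nat; apply: ler_sum => i /andP[_ iJ].
rewrite -expRD ler_expR.
have -> : - a + - a * k.+1%:R `^ b = - a * (k.+1%:R `^ b + 1) by ring.
rewrite !mulNr lerN2 ler_pM2l //.
have -> : (i + k).+1%:R = k.+1%:R + i%:R :> R by rewrite -natrD; congr (_%:R); lia.
apply: le_trans (powR_add_le _ _ b1) _ => //.
rewrite mulrDr mulr1 lerD2l mulrC -mulrA.
rewrite -powR_inv1 // -powRD; last by rewrite pnatr_eq0 implybT.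
have -> : -1 + b = - (1 - b) by ring.
rewrite powRN ler_pdivrMr ?powR_gt0 // mul1r.
apply: (@le_trans _ _ J%:R); first by rewrite ler_nat.
apply: le_trans Js _; apply: ge0_ler_powR; rewrite ?nnegrE ?ler_nat //; lra.
Qed.

(** * Rounding quadratic forms to a grid *)

(** Consider the form minus [c] times the squared norm.  In one coordinate [j]
    it is a quadratic polynomial with leading coefficient at most
    [\sum_i a i j ^+ 2], so that its value between two neighbouring grid values
    falls short of their interpolation by at most [del^2 / 4] times this
    coefficient.  Rounding one coordinate after the other, the total loss
    involves the trace of the form and not its largest eigenvalue.  The
    condition on [del] keeps the rounded points in the ball of radius [2]. *)
Lemma quadratic_form_rounding (R : realType) (I : finType) (k : nat)
  (a : I -> 'I_k -> R) (c del : R) :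
  0 <= c -> 0 < del -> k%:R * del ^+ 2 <= 1 ->
  (forall z : 'I_k -> int, \sum_j (del * (z j)%:~R) ^+ 2 <= 4 ->
     c * \sum_j (del * (z j)%:~R) ^+ 2 <=
         \sum_i (\sum_j a i j * (del * (z j)%:~R)) ^+ 2) ->
  forall v : 'I_k -> R, \sum_j v j ^+ 2 = 1 ->
  c - del ^+ 2 / 4 * \sum_j \sum_i a i j ^+ 2 <= \sum_i (\sum_j a i j * v j) ^+ 2.
Proof.
move=> c0 del0 kdel grid v v1.
pose q (x : 'I_k -> R) := \sum_i (\sum_j a i j * x j) ^+ 2 - c * \sum_j x j ^+ 2.
(* In [h], coordinates below [m] are those of [v] and the others lie on the
   grid. *)
suff h m : forall x : 'I_k -> R,
    (forall j, `|x j - v j| <= del) ->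
    (forall j : 'I_k, (m <= j)%N -> exists z : int, x j = del * z%:~R) ->
    (forall j : 'I_k, (j < m)%N -> x j = v j) ->
    - (del ^+ 2 / 4 * \sum_(j < k | (j < m)%N) \sum_i a i j ^+ 2) <= q x.
  have hk : - (del ^+ 2 / 4 * \sum_(j < k | (j < k)%N) \sum_i a i j ^+ 2) <= q v.
    apply: h => // j; first by rewrite subrr normr0 ltW.
    by rewrite leqNgt ltn_ord.
  move: hk; rewrite /q v1 mulr1 (eq_bigl xpredT); last by move=> j; rewrite ltn_ord.
  by move=> ?; lra.
elim: m => [|m IH] x xv xz xm.
  rewrite big_pred0 // mulr0 oppr0 /q subr_ge0.
  have /choice[z zE] : forall j, exists z : int, x j = del * z%:~R by move=> j;
      exact: xz.
  under eq_bigr do rewrite zE.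
  under [in leRHS]eq_bigr do under eq_bigr do rewrite zE.
  apply: grid; under eq_bigr do rewrite -zE.
  apply: (@le_trans _ _ (\sum_j (2 * v j ^+ 2 + 2 * del ^+ 2))).
    apply: ler_sum => j _; have := xv j; rewrite ler_norml => /andP[h1 h2].
    have h3 : 0 <= (2 * v j - x j) ^+ 2 by exact: sqr_ge0.
    have h4 : (x j - v j) ^+ 2 <= del ^+ 2.
      have := mulr_ge0 (_ : 0 <= del - (x j - v j)) (_ : 0 <= del + (x j - v j)).
      by move=> /(_ ltac:(lra) ltac:(lra)); lra.
    nra.
  rewrite big_split /= -mulr_sumr v1 sumr_const card_ord -mulr_natl; nra.
case: (ltnP m k) => mk; last first.
  have -> : \sum_(j < k | (j < m.+1)%N) \sum_i a i j ^+ 2 =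
      \sum_(j < k | (j < m)%N) \sum_i a i j ^+ 2.
    apply: eq_bigl => j; have := ltn_ord j; lia.
  apply: IH => // j jm; first by have := ltn_ord j; lia.
  by apply: xm; lia.
pose jm := Ordinal mk.
pose f := Num.floor (v jm / del).
pose lo := del * f%:~R.
pose th := v jm / del - f%:~R.
have thE : v jm = lo + th * del by rewrite /lo /th; field; lra.
have th0 : 0 <= th by rewrite subr_ge0 floor_le_tmp.
have th1 : th <= 1.
  by rewrite lerBlDr; have := floorD1_gt (v jm / del); rewrite intrD => /ltW;
      rewrite -/f; lra.
pose upd (t : R) (j : 'I_k) := if j == jm then t else x j.
have qlo t : (t = lo \/ t = lo + del) ->
   - (del ^+ 2 / 4 * \sum_(j < k | (j < m)%N) \sum_i a i j ^+ 2) <= q (upd t).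
  move=> ht; apply: IH => j.
  - rewrite /upd; case: eqP => [->|_]; last exact: xv.
    rewrite thE ler_norml; case: ht => ->; nra.
  - move=> mj; rewrite /upd; case: eqP => [_|/eqP jn].
      by case: ht => ->; [exists f|exists (f + 1); rewrite intrD /lo; ring].
    apply: xz; rewrite ltn_neqAle mj andbT; apply: contra jn => /eqP e.
    by apply/eqP/val_inj.
  - move=> mj; rewrite /upd; case: eqP => [e|_]; last by apply: xm; lia.
    by move: mj; rewrite e /= ltnn.
have lin (F : 'I_k -> R -> R) t : \sum_j F j (upd t j) = F jm t +
    \sum_(j < k | j != jm) F j (x j).
  rewrite (bigD1 jm) //= /upd eqxx; congr (_ + _); apply: eq_bigr => j /negbTE -> //.
have xE : x = upd (v jm).
  by apply/funext => j; rewrite /upd; case: eqP => // ->; apply: xm => /=.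
have key : (1 - th) * q (upd lo) + th * q (upd (lo + del)) - q x =
   th * (1 - th) * del ^+ 2 * (\sum_i a i jm ^+ 2 - c).
  have qE t : q (upd t) = \sum_i (a i jm * t + \sum_(j < k | j != jm) a i j * x j) ^+ 2
     - c * (t ^+ 2 + \sum_(j < k | j != jm) x j ^+ 2).
    rewrite /q (lin (fun _ y => y ^+ 2)); congr (_ - _); apply: eq_bigr => i _.
    by rewrite (lin (fun j y => a i j * y)).
  rewrite [in q x]xE !qE.
  set V := \sum_(j < k | j != jm) x j ^+ 2.
  have -> : \sum_i (a i jm * v jm + \sum_(j < k | j != jm) a i j * x j) ^+ 2 =
    (1 - th) * \sum_i (a i jm * lo + \sum_(j < k | j != jm) a i j * x j) ^+ 2 +
    th * \sum_i (a i jm * (lo + del) + \sum_(j < k | j != jm) a i j * x j) ^+ 2 -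
    th * (1 - th) * del ^+ 2 * \sum_i a i jm ^+ 2.
    rewrite !mulr_sumr -!big_split /= -sumrN -big_split /=.
    by apply: eq_bigr => i _; rewrite thE; ring.
  by rewrite thE; ring.
rewrite (bigD1 jm) //= (eq_bigl (fun j : 'I_k => (j < m)%N)); last first.
  move=> j; rewrite ltnS leq_eqVlt.
  have -> : (j != jm) = (j != m :> nat) by [].
  by case: ltngtP.
have := qlo lo (or_introl erefl); have := qlo (lo + del) (or_intror erefl).
set s := \sum_(_ | _) _; set s' := \sum_i a i jm ^+ 2.
set qa := q (upd lo) in key *; set qb := q (upd (lo + del)) in key *.
have s'0 : 0 <= s' by apply: sumr_ge0 => i _; exact: sqr_ge0.
move=> h1 h2.
have h3 : (1 - th) * (- (del ^+ 2 / 4 * s)) <=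
    (1 - th) * qa by rewrite ler_wpM2l // subr_ge0.
have h4 : th * (- (del ^+ 2 / 4 * s)) <= th * qb by rewrite ler_wpM2l.
have h5 : th * (1 - th) <= 1 / 4 by have := sqr_ge0 (th - 1/2); nra.
have h6 : th * (1 - th) * del ^+ 2 * (s' - c) <= del ^+ 2 / 4 * s'.
  apply: (@le_trans _ _ (th * (1 - th) * del ^+ 2 * s')).
    apply: ler_wpM2l; last lra. rewrite mulr_ge0 ?sqr_ge0 //; nra.
  rewrite ler_wpM2r //; have := sqr_ge0 del; nra.
rewrite -/s' in key; lra.
Qed.

(** Sign and absolute value, so that the weight in [grid_weight] depends on the
    second component alone.  Zero has two codes, harmless in a union bound. *)
Definition signed_nat (M : nat) (p : bool * 'I_M.+1) : int :=
    (-1) ^+ p.1 * (p.2 : nat)%:Z.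

Lemma signed_natP (M : nat) (z : int) : (`|z| <= M)%N ->
    exists p, signed_nat (M := M) p = z.
Proof.
move=> zM; exists ((z < 0)%R, inord `|z|%N).
by rewrite /signed_nat /= inordK // -intEsign.
Qed.

Lemma absz_le_sqr (R : realType) (z : int) : `|z|%N%:R <= z%:~R ^+ 2 :> R.
Proof.
have -> : z%:~R ^+ 2 = `|z|%N%:R ^+ 2 :> R.
  by rewrite natr_absz intr_norm real_normK // num_real.
case: (absz z) => [|m]; first by rewrite expr0n.
have : 1 <= m.+1%:R :> R by rewrite ler1n.
by move: (m.+1%:R) => x; nra.
Qed.

(** The sum factorizes over coordinates, and each factor is at most
    [4 <= exp 2].  Consequently at most [exp (N + 2 k)] integer vectors have
    squared norm at most [N]. *)
Lemma grid_weight (R : realType) (M k : nat) :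
  \sum_(f : {ffun 'I_k -> bool * 'I_M.+1}) expR
      (- \sum_j (signed_nat (f j))%:~R ^+ 2 : R)
   <= expR (2 * k%:R).
Proof.
have two_le_e := expR1_ge2 R.
under eq_bigr do rewrite -sumrN expR_sum.
rewrite -(bigA_distr_bigA (fun (_ : 'I_k) p =>
    expR (- (signed_nat (M := M) p)%:~R ^+ 2 : R))) /=.
rewrite prodr_const card_ord (expRM_natr k).
set S := \sum_(_ | _) _.
have S0 : 0 <= S by apply: sumr_ge0 => p _; exact: expR_ge0.
rewrite lerXn2r ?nnegrE ?expR_ge0 //.
have sq (p : bool * 'I_M.+1) : expR (- (signed_nat p)%:~R ^+ 2 : R) <= 2^-1 ^+ p.2.
  have -> : (signed_nat p)%:~R ^+ 2 = (p.2%:R) ^+ 2 :> R.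
    by rewrite /signed_nat intrM rmorphXn /=
        exprMn -exprM mulnC exprM sqrrN expr1n expr1n mul1r.
  apply: (@le_trans _ _ (expR (p.2%:R * - 1))).
    rewrite ler_expR mulrN1 lerN2; case: (p.2 : nat) => [|m]; first by rewrite expr0n.
    have : 1 <= m.+1%:R :> R by rewrite ler1n.
    nra.
  rewrite expRM_natl lerXn2r ?nnegrE ?expR_ge0 ?invr_ge0 //.
  by rewrite expRN lef_pV2 ?posrE ?expR_gt0.
apply: (@le_trans _ _ (\sum_(p : bool * 'I_M.+1) 2^-1 ^+ p.2)).
  by apply: ler_sum => p _; exact: sq.
rewrite -(pair_big xpredT xpredT (fun (_ : bool) (m : 'I_M.+1) => 2^-1 ^+ m)) /=
    big_bool /=.
have -> : \sum_(m < M.+1) 2^-1 ^+ m = 2 - 2 * 2^-1 ^+ M.+1 :> R.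
  elim: M {S S0 sq} => [|M IH]; first by rewrite big_ord_recl big_ord0 /= expr0 expr1;
      field.
  by rewrite big_ord_recr /= IH !exprS; field.
have : 0 <= 2^-1 ^+ M.+1 :> R by rewrite exprn_ge0 // invr_ge0.
have : expR 2 = expR 1 * expR 1 :> R by rewrite -expRD.
nra.
Qed.

(** * Independence and the Chernoff bound *)

Section factorization.
Context d1 d2 (T : measurableType d1) (V : measurableType d2) (R : realType).
Variables (P : {measure set T -> \bar R}) (Z : T -> R) (g : T -> V).
Hypotheses (mZ : measurable_fun setT Z) (Z0 : forall w, 0 <= Z w).
Hypothesis mg : measurable_fun setT g.
Import HBNNSimple.

(** In the intended case [Z] is independent of [g], with mean [c].  Linearity
    passes from indicators to simple functions, monotone convergence from there
    to nonnegative functions. *)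
Lemma integral_mulr_comp_of_indic (c : R) (phi : V -> R) : 0 <= c ->
  (forall B, measurable B ->
     (\int[P]_w (Z w * \1_B (g w))%:E = c%:E * P (g @^-1` B))%E) ->
  measurable_fun setT phi -> (forall x, 0 <= phi x) ->
  (\int[P]_w (Z w * phi (g w))%:E = c%:E * \int[P]_w (phi (g w))%:E)%E.
Proof.
move=> c0 hB mphi phi0.
have mpre B : measurable B -> measurable (g @^-1` B).
  by move=> mB; rewrite -[_ @^-1` _]setTI; exact: mg.
have mind B : measurable B -> measurable_fun setT (fun w => \1_B (g w) : R).
  by move=> mB; apply: measurableT_comp.
have hr (s : {nnsfun V >-> R}) r :
    (\int[P]_w (Z w * (r * \1_(s @^-1` [set r]) (g w)))%:E =
     c%:E * \int[P]_w (r * \1_(s @^-1` [set r]) (g w))%:E)%E.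
  set B := s @^-1` [set r].
  have mB : measurable B by exact: measurable_sfunP.
  case: (lerP 0 r) => r0; last first.
    have B0 x : r * \1_B x = 0 :> R.
      rewrite indicE; case: (boolP (x \in B)) => [|_]; rewrite ?mulr0 //.
      by rewrite inE /B => /= rs; move: r0; rewrite -rs ltNge fun_ge0.
    under eq_integral do rewrite B0 mulr0.
    under [in RHS]eq_integral do rewrite B0.
    by rewrite integral0 mule0.
  under eq_integral do rewrite mulrCA EFinM.
  under [in RHS]eq_integral do rewrite EFinM.
  rewrite !ge0_integralZl_EFin //=.
  - rewrite hB // muleCA; congr (_ * (_ * _))%E.
    rewrite (_ : (fun w => _) = (fun w => (\1_(g @^-1` B) w)%:E)) //.
    by rewrite integral_indic ?setIT //; exact: mpre.
  - by apply/measurable_EFinP; exact: mind.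
  - by move=> x _; rewrite lee_fin mulr_ge0.
  - by apply/measurable_EFinP; apply: measurable_funM => //; exact: mind.
have hs (s : {nnsfun V >-> R}) :
    (\int[P]_w (Z w * s (g w))%:E = c%:E * \int[P]_w (s (g w))%:E)%E.
  under eq_integral do rewrite fimfunE.
  under [in RHS]eq_integral do rewrite fimfunE -fsumEFin //.
  rewrite ge0_integral_fsum //; last 2 first.
  - move=> r; apply/measurable_EFinP; apply: measurable_funM => //; exact: mind.
  - by move=> r x _; exact: nnfun_muleindic_ge0.
  rewrite ge0_mule_fsumr; last first.
    by move=> r; apply: integral_ge0 => x _; exact: nnfun_muleindic_ge0.
  transitivity (\int[P]_w \sum_(r \in range s)
      (Z w * (r * \1_(s @^-1` [set r]) (g w)))%:E)%E.
    apply: eq_integral => w _; rewrite EFinM -fsumEFin // ge0_mule_fsumr //.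
    by move=> r; exact: nnfun_muleindic_ge0.
  rewrite ge0_integral_fsum //; last 2 first.
  - move=> r; apply/measurable_EFinP; apply: measurable_funM => //.
    apply: measurable_funM => //; exact: mind.
  - by move=> r x _; rewrite lee_fin mulr_ge0 // -lee_fin EFinM nnfun_muleindic_ge0.
  by apply: eq_fsbigr => r _; exact: hr.
have mEphi : measurable_fun setT (EFin \o phi) by exact/measurable_EFinP.
pose s_ := nnsfun_approx measurableT mEphi.
have cv x : EFin \o s_ ^~ x @ \oo --> (phi x)%:E.
  by apply: (@cvg_nnsfun_approx _ _ _ _ measurableT _ mEphi) => // y _; rewrite lee_fin.
have nd x m n : (m <= n)%N -> s_ m x <= s_ n x.
  by move=> mn; exact/lefP/nd_nnsfun_approx.
have e1 : (\int[P]_w (Z w * phi (g w))%:E = limn (fun n =>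
    \int[P]_w (Z w * s_ n (g w))%:E))%E.
  rewrite -monotone_convergence //.
  - apply: eq_integral => w _; apply/esym/cvg_lim => //.
    under eq_fun do rewrite EFinM.
    rewrite (EFinM (Z w)).
    by apply: cvgeZl => //; exact: cv.
  - move=> n; apply/measurable_EFinP/measurable_funM => //.
    by apply: measurableT_comp => //; exact: measurable_funP.
  - by move=> n w _; rewrite lee_fin mulr_ge0.
  - by move=> w _ m n mn; rewrite lee_fin ler_wpM2l // nd.
have e2 : (c%:E * \int[P]_w (phi (g w))%:E = limn (fun n =>
    c%:E * \int[P]_w (s_ n (g w))%:E))%E.
  have mgs n : measurable_fun setT (EFin \o (s_ n \o g)).
    by apply/measurable_EFinP/measurableT_comp => //; exact: measurable_funP.
  rewrite -ge0_integralZl_EFin //=; last 2 first.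
  - by move=> w _; rewrite lee_fin.
  - by apply/measurable_EFinP/measurableT_comp.
  have -> : (fun n => c%:E * \int[P]_w (s_ n (g w))%:E)%E =
            (fun n => \int[P]_w (c%:E * (s_ n (g w))%:E))%E.
    apply/funext => n; rewrite ge0_integralZl_EFin //.
      by move=> w _; rewrite lee_fin.
    exact: mgs.
  rewrite -monotone_convergence //.
  - apply: eq_integral => w _; apply/esym/cvg_lim => //.
    by apply: cvgeZl => //; exact: cv.
  - by move=> n; apply: measurable_funeM; exact: mgs.
  - by move=> n w _; rewrite mule_ge0 ?lee_fin.
  - by move=> w _ m n mn; rewrite lee_wpmul2l ?lee_fin // nd.
rewrite e1 e2; congr (limn _); apply/funext => n; exact: hs.
Qed.
End factorization.

Lemma indic_bigcap_seq (T : Type) (R : realType) (I : eqType) (J : seq I)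
    (F : I -> set T) w :
  \prod_(i <- J) (\1_(F i) w : R) = \1_(\bigcap_(i in [set` J]) F i) w.
Proof.
rewrite indicE; case: (boolP (w \in _)) => [|].
  rewrite inE => h; rewrite big_seq big1 // => i iJ.
  by rewrite indicE mem_set //; exact: h.
move=> h; have [i iJ Fi] : exists2 i, i \in J & ~ F i w.
  apply: contrapT => H; move/negP: h; apply; rewrite inE => i /= iJ.
  by apply: contrapT => Fi; apply: H; exists i.
by rewrite (big_rem i) //= indicE memNset // mul0r.
Qed.

(** Independence is the case of indicators; they are replaced by the [phi i]
    one index at a time, with [integral_mulr_comp_of_indic] applied to the
    product of the remaining factors. *)
Lemma independent_integral_prod (R : realType) d (T : measurableType d)
    (P : probability T R)
    (I : eqType) d1 (V : measurableType d1) (f : I -> T -> V) (phi : I -> V ->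
        R) (J : seq I) :
  independent_family P f -> (forall i, measurable_fun setT (f i)) ->
  (forall i, measurable_fun setT (phi i)) -> (forall i x, 0 <= phi i x) ->
  (forall i, \int[P]_w (phi i (f i w))%:E < +oo)%E ->
  uniq J ->
  (\int[P]_w (\prod_(i <- J) phi i (f i w))%:E =
      \prod_(i <- J) \int[P]_w (phi i (f i w))%:E)%E.
Proof.
move=> ind mf mphi phi0 phioo.
have mpre i B : measurable B -> measurable (f i @^-1` B).
  by move=> mB; rewrite -[_ @^-1` _]setTI; exact: mf.
have Efin i : (\int[P]_w (phi i (f i w))%:E)%E \is a fin_num.
  by rewrite ge0_fin_numE // integral_ge0 // => w _; rewrite lee_fin.
suff h J1 J2 (B : I -> set V) : uniq (J1 ++ J2) -> (forall i, measurable (B i)) ->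
  (\int[P]_w (\prod_(i <- J1) phi i (f i w) * \prod_(i <- J2) \1_(B i) (f i w))%:E =
   \prod_(i <- J1) \int[P]_w (phi i (f i w))%:E * \prod_(i <- J2) P (f i @^-1` B i))%E.
  move=> uJ; have := h J [::] (fun=> setT); rewrite cats0 big_nil mule1 => <- //.
  by apply: eq_integral => w _; rewrite big_nil mulr1.
elim: J1 J2 B => [|i J1 IH] J2 B uJ mB.
  under eq_integral do rewrite big_nil mul1r.
  rewrite big_nil mul1e -ind //.
  set F := \bigcap_(i in _) _.
  rewrite -[F in RHS]setIT -integral_indic //.
    by apply: eq_integral => w _; rewrite -indic_bigcap_seq.
  by apply: fin_bigcap_measurable => [|j _]; [exact: finite_seq|exact: mpre].
pose c := (\prod_(j <- J1) \int[P]_w (phi j (f j w))%:E * \prod_(j <- J2) P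
    (f j @^-1` B j))%E.
have c0 : (0 <= c)%E.
  rewrite mule_ge0 // prode_ge0 // => j _; apply: integral_ge0 => w _;
      rewrite lee_fin //.
have cfin : c \is a fin_num.
  rewrite fin_numM //; apply: prode_fin_num => j _ //.
  by apply: fin_num_measure; exact: mpre.
transitivity (\int[P]_w ((\prod_(j <- J1) phi j (f j w) * \prod_(j <- J2) \1_(B j)
    (f j w)) * phi i (f i w))%:E)%E.
  by apply: eq_integral => w _; rewrite big_cons; congr EFin; ring.
rewrite (@integral_mulr_comp_of_indic _ _ _ _ _ _ _ (f i) _ _ _ (fine c)) //.
- by rewrite fineK // big_cons /c muleC muleA.
- apply: measurable_funM; apply: measurable_prod => j _; first exact: measurableT_comp.
  by apply: measurableT_comp.
- by move=> w; apply: mulr_ge0; apply: prodr_ge0.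
- exact: fine_ge0.
- move=> B0 mB0; rewrite fineK //.
  have iJ2 : i \notin J2 by move: uJ; rewrite /= mem_cat negb_or => /andP[/andP[]].
  pose B' j := if j == i then B0 else B j.
  have BB' j : j \in J2 -> B' j = B j.
    by rewrite /B'; case: eqP => // -> ji; rewrite ji in iJ2.
  have B'i : B' i = B0 by rewrite /B' eqxx.
  have e1 : (\prod_(j <- J2) P (f j @^-1` B' j) = \prod_(j <- J2) P (f j @^-1` B j))%E.
    by apply: eq_big_seq => j /BB' ->.
  have uq : uniq (J1 ++ i :: J2) by rewrite -cat1s uniq_catCA.
  have mB' j : measurable (B' j) by rewrite /B'; case: eqP.
  have := IH (i :: J2) B' uq mB'.
  rewrite big_cons B'i e1 => IHe.
  rewrite /c -muleA [(\prod_(j <- J2) _ * _)%E]muleC -IHe.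
  apply: eq_integral => w _; rewrite big_cons B'i.
  have -> : \prod_(j <- J2) \1_(B' j) (f j w) = \prod_(j <- J2) \1_(B j) (f j w) :> R.
    by apply: eq_big_seq => j /BB' ->.
  congr EFin; ring.
Qed.

Lemma same_distribution_integral (R : realType) d1 d2 d (T1 : measurableType d1)
    (T2 : measurableType d2) (V : measurableType d) (P1 : probability T1 R)
    (P2 : probability T2 R) (f1 : T1 -> V) (f2 : T2 -> V) (phi : V -> R) :
  measurable_fun setT f1 -> measurable_fun setT f2 -> same_distribution P1 P2 f1 f2 ->
  measurable_fun setT phi -> (forall x, 0 <= phi x) ->
  (\int[P1]_w (phi (f1 w))%:E = \int[P2]_w (phi (f2 w))%:E)%E.
Proof.
move=> mf1 mf2 same mphi phi0.
have mE : measurable_fun setT (EFin \o phi) by exact/measurable_EFinP.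
transitivity (\int[pushforward P1 f1]_y (phi y)%:E)%E.
  rewrite (@ge0_integral_pushforward _ _ _ _ _ _ mf1) ?preimage_setT //.
  by move=> y _; rewrite lee_fin.
transitivity (\int[pushforward P2 f2]_y (phi y)%:E)%E; last first.
  rewrite (@ge0_integral_pushforward _ _ _ _ _ _ mf2) ?preimage_setT //.
  by move=> y _; rewrite lee_fin.
by apply: eq_measure_integral => A mA _; exact: same.
Qed.

Lemma probability_bigsetU_le (R : realType) d (T : measurableType d)
    (P : probability T R)
    (I : Type) (r : seq I) (E : I -> set T) : (forall i, measurable (E i)) ->
  (P (\big[setU/set0]_(i <- r) E i) <= \sum_(i <- r) P (E i))%E.
Proof.
move=> mE; elim: r => [|i r IH]; first by rewrite !big_nil measure0.
rewrite !big_cons; apply: (@le_trans _ _ (P (E i) +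
    P (\big[setU/set0]_(j <- r) E j))%E).
  by apply: measureU2 => //; exact: bigsetU_measurable.
exact: leeD2l.
Qed.

Lemma lee_prode (R : realType) (I : Type) (r : seq I) (F : I -> \bar R) (a : I -> R) :
  (forall i, 0 <= F i <= (a i)%:E)%E ->
      (\prod_(i <- r) F i <= (\prod_(i <- r) a i)%:E)%E.
Proof.
move=> h; elim: r => [|i r IH]; first by rewrite !big_nil.
rewrite !big_cons EFinM; have /andP[h1 h2] := h i.
apply: lee_pmul => //; apply: prode_ge0 => j _.
by have /andP[] := h j.
Qed.

(** Markov's inequality for the exponential of the sum. *)
Lemma chernoff_independent (R : realType) d (T : measurableType d) (P : probability T R)
    d1 (V : measurableType d1) (n : nat) (f : 'I_n -> T -> V) (phi : V -> R) (a b : R) :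
  independent_family P f -> (forall i, measurable_fun setT (f i)) ->
  measurable_fun setT phi ->
  (forall i, \int[P]_w (expR (phi (f i w)))%:E <= (expR a)%:E)%E ->
  (P [set w | (n%:R * b <= \sum_i phi (f i w))%R] <= (expR (- (n%:R * (b - a))))%:E)%E.
Proof.
move=> ind mf mphi Ephi.
set A := [set w | _].
have mS : measurable_fun setT (fun w => \sum_i phi (f i w)).
  by apply: measurable_sum => i; exact: measurableT_comp.
have mA : measurable A.
  by rewrite -[A]setTI; apply: measurable_fun_le.
have mexp : measurable_fun setT (fun x => expR (phi x)) by exact: measurableT_comp.
have h : ((expR (n%:R * b))%:E * P A <= (expR a ^+ n)%:E)%E.
  apply: (@le_trans _ _ (\int[P]_w (\prod_i expR (phi (f i w)))%:E)%E).
    rewrite -[X in P X]setIT -integral_indic // -ge0_integralZl_EFin ?expR_ge0 //;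
        last first.
      by apply/measurable_EFinP; exact: measurable_indic.
    apply: ge0_le_integral => //.
    - by apply/measurable_EFinP/measurable_funM => //; exact: measurable_indic.
    - by apply/measurable_EFinP; apply: measurable_prod => i _;
        exact: (measurableT_comp mexp (mf i)).
    - move=> w _; rewrite -EFinM lee_fin -expR_sum indicE.
      case: (boolP (w \in A)); rewrite ?mulr0 ?mulr1 ?expR_ge0 // inE /A /= => h.
      by rewrite ler_expR.
  rewrite (@independent_integral_prod _ _ _ _ _ _ _ f (fun=> expR \o phi)) //.
  - have := @lee_prode R 'I_n (index_enum _) (fun i =>
      \int[P]_w (expR (phi (f i w)))%:E)%E (fun=> expR a).
    rewrite prodr_const card_ord; apply => i.
    by rewrite Ephi andbT integral_ge0 // => w _; rewrite lee_fin expR_ge0.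
  - by move=> i x; exact: expR_ge0.
  - by move=> i; apply: le_lt_trans (Ephi i) _; exact: ltry.
  - exact: index_enum_uniq.
have -> : - (n%:R * (b - a)) = - (n%:R * b) + n%:R * a by ring.
rewrite expRD expRM_natl EFinM.
apply: (@le_trans _ _ ((expR (- (n%:R * b)))%:E * ((expR (n%:R * b))%:E * P A))%E).
  by rewrite muleA -EFinM -expRD addNr expR0 mul1e.
by rewrite lee_pmul2l ?fin_numE // lte_fin expR_gt0.
Qed.

(** * Exponential moments of sub-Gaussian variables *)

Section moments.
Context (R : realType) d (T : measurableType d) (P : probability T R).
Implicit Types f g : T -> R.

Lemma ge0_le_integral_EFin f g : measurable_fun setT f -> measurable_fun setT g ->
  (forall w, 0 <= f w) -> (forall w, f w <= g w) ->
  (\int[P]_w (f w)%:E <= \int[P]_w (g w)%:E)%E.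
Proof.
move=> mf mg f0 fg; apply: ge0_le_integral => //; try exact/measurable_EFinP.
- by move=> w _; rewrite lee_fin; exact: f0.
- by move=> w _; rewrite lee_fin; exact: fg.
Qed.

Lemma integral_cst_probability (k : R) : (\int[P]__ k%:E = k%:E)%E.
Proof. by rewrite -[RHS](expectation_cst P k) unlock. Qed.

Lemma psi2_norm_moment (L : R) f (k : nat) : 0 < L ->
  (psi2_norm P f <= L%:E)%E ->
  (\int[P]_w (f w ^+ (2 * k))%:E <= ((2 * L ^+ 2 * k%:R) ^+ k)%:E)%E.
Proof.
move=> L0 hL; case: k => [|k].
  under eq_integral do rewrite muln0 expr0.
  by rewrite expr0 integral_cst_probability.
set q : R := (2 * k.+1)%:R.
have q1 : 1 <= q by rewrite /q ler1n; lia.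
have q0 : 0 < q by lra.
have hN : ('N[P]_(q%:E)[EFin \o f] <= (L * Num.sqrt q)%:E)%E.
  have : ((Num.sqrt q)^-1%:E * 'N[P]_(q%:E)[EFin \o f] <= L%:E)%E.
    apply: le_trans hL; apply: ereal_sup_ubound; exists q => //.
  rewrite muleC EFinM => h.
  have sq0 : 0 < Num.sqrt q by rewrite sqrtr_gt0.
  rewrite -(mule1 'N[P]_(q%:E)[_]%E) -(mulVf (lt0r_neq0 sq0)) EFinM muleA.
  by rewrite lee_pmul2r // lte_fin.
have -> : (\int[P]_w (f w ^+ (2 * k.+1))%:E = 'N[P]_(q%:E)[EFin \o f] `^ q)%E.
  rewrite poweR_Lnorm ?gt_eqF //; apply: eq_integral => w _ /=.
  by rewrite powR_mulrn // -normrX ger0_norm // exprM exprn_ge0 // sqr_ge0.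
apply: le_trans (_ : (L * Num.sqrt q)%:E `^ q <= _)%E.
  apply: gt0_ler_poweR; rewrite ?in_itv /=
      ?andbT ?leey ?Lnorm_ge0 ?lee_fin ?(ltW q0) //.
  by rewrite mulr_ge0 ?sqrtr_ge0 // ltW.
rewrite poweR_EFin lee_fin /q powR_mulrn; last by rewrite mulr_ge0 ?sqrtr_ge0 // ltW.
have -> : (L * Num.sqrt (2 * k.+1)%:R) ^+ (2 * k.+1) = (2 * L ^+ 2 * k.+1%:R) ^+ k.+1.
  rewrite exprM; congr (_ ^+ _); rewrite (exprMn 2) sqr_sqrtr ?ler0n // natrM.
  ring.
exact: lexx.
Qed.

(** In the power series of the exponential, the bound on the moment of order
    [2 k] and [k^k <= e^k k!] make the [k]-th term at most [2^-k]; this is where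
    the factor [4 e L^2] comes from. *)
Lemma psi2_norm_expR_sq (L : R) f : 0 < L -> measurable_fun setT f ->
  (psi2_norm P f <= L%:E)%E ->
  (\int[P]_w (expR ((4 * expR 1 * L ^+ 2)^-1 * f w ^+ 2))%:E <= 2%:E)%E.
Proof.
move=> L0 mf hL; set s := (_)^-1.
have e0 := expR_gt0 (1 : R).
have s0 : 0 < s by rewrite /s invr_gt0 !mulr_gt0 // exprn_gt0.
pose g N w := series (exp_coeff (s * f w ^+ 2)) N.
have gE N w : g N w = \sum_(0 <= k < N) s ^+ k / k`!%:R * f w ^+ (2 * k).
  rewrite /g /series /=; apply: eq_bigr => k _.
  by rewrite /exp_coeff /= exprMn exprM; ring.
have sk k : 0 <= s ^+ k / k`!%:R by rewrite divr_ge0 ?ler0n // exprn_ge0 // ltW.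
have fk k w : 0 <= f w ^+ (2 * k) by rewrite exprM exprn_ge0 // sqr_ge0.
have mfk k : measurable_fun setT (fun w => f w ^+ (2 * k)) by exact: measurable_funX.
have mg N : measurable_fun setT (g N).
  rewrite (_ : g N = fun w => \sum_(0 <= k < N) s ^+ k / k`!%:R * f w ^+ (2 * k)).
    by apply: measurable_sum => k; exact: measurable_funM.
  by apply/funext => w; exact: gE.
have g0 N w : 0 <= g N w by rewrite gE; apply: sumr_ge0 => k _; rewrite mulr_ge0.
have gm w m n : (m <= n)%N -> g m w <= g n w.
  move=> mn; rewrite !gE (big_cat_nat (leq0n m) mn) //= lerDl.
  by apply: sumr_ge0 => k _; rewrite mulr_ge0.
rewrite (_ : (\int[P]_w _ = limn (fun N => \int[P]_w (g N w)%:E))%E); last first.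
  rewrite -monotone_convergence //.
  - apply: eq_integral => w _; apply/esym/cvg_lim => //.
    apply: cvg_EFin; first by near=> n.
    exact: is_cvg_series_exp_coeff.
  - by move=> N; exact/measurable_EFinP.
  - by move=> N w _; rewrite lee_fin.
  - by move=> w _ m n mn; rewrite lee_fin; exact: gm.
have gi N : (\int[P]_w (g N w)%:E <= 2%:E)%E.
  under eq_integral do rewrite gE -sumEFin.
  rewrite ge0_integral_sum //; last 2 first.
  - by move=> k; apply/measurable_EFinP/measurable_funM.
  - by move=> k w _; rewrite lee_fin mulr_ge0.
  apply: (@le_trans _ _ (\sum_(0 <= k < N) (2^-1 ^+ k)%:E)%E).
    apply: lee_sum => k _.
    under eq_integral do rewrite EFinM.
    rewrite ge0_integralZl_EFin //; last 2 first.
    - by move=> w _; rewrite lee_fin.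
    - exact/measurable_EFinP.
    apply: (@le_trans _ _ ((s ^+ k / k`!%:R)%:E * ((2 * L ^+ 2 * k%:R) ^+ k)%:E)%E).
      by rewrite lee_wpmul2l ?lee_fin ?sk // psi2_norm_moment.
    rewrite -EFinM lee_fin exprMn.
    apply: (@le_trans _ _ (s ^+ k / k`!%:R
        * ((2 * L ^+ 2) ^+ k * (expR 1 ^+ k * k`!%:R)))).
      rewrite ler_wpM2l // ler_wpM2l ?expnn_le_fact // exprn_ge0 //.
      by rewrite mulr_ge0 // exprn_ge0 // ltW.
    have k0 : k`!%:R != 0 :> R by rewrite pnatr_eq0 -lt0n fact_gt0.
    have -> : s ^+ k / k`!%:R * ((2 * L ^+ 2) ^+ k * (expR 1 ^+ k * k`!%:R)) =
        (s * (2 * L ^+ 2) * expR 1) ^+ k.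
      by rewrite !exprMn; field.
    rewrite le_eqVlt; apply/orP; left; apply/eqP; congr (_ ^+ _).
    by rewrite /s; field; rewrite ?gt_eqF.
  rewrite sumEFin lee_fin.
  have -> : \sum_(0 <= k < N) 2^-1 ^+ k = 2 - 2 * 2^-1 ^+ N :> R.
    elim: N => [|N IH]; first by rewrite big_geq // expr0; ring.
    by rewrite big_nat_recr //= IH exprS; field.
  by rewrite lerBlDr lerDl mulr_ge0 // exprn_ge0 // invr_ge0.
apply: lime_le; last by near=> N; exact: gi.
apply: ereal_nondecreasing_is_cvgn => m n mn.
by apply: ge0_le_integral_EFin => // w; exact: gm.
Unshelve. all: by end_near. Qed.

(** [expR_le_add_sq] removes the mean, and [expR_chord] trades the exponent
    [2 t^2] for [s]. *)
Lemma expR_moment_subgaussian f (s t : R) : measurable_fun setT f -> 0 < s ->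
  2 * t ^+ 2 <= s ->
  (\int[P]_w (f w)%:E = 0)%E ->
  (\int[P]_w (expR (s * f w ^+ 2))%:E <= 2%:E)%E ->
  (\int[P]_w (expR (t * f w))%:E <= (expR (2 * t ^+ 2 / s))%:E)%E.
Proof.
move=> mf s0 ts f0 fs.
have mexp (c : R) : measurable_fun setT (fun w => expR (c * f w ^+ 2)).
  apply: measurableT_comp => //; apply: measurable_funM => //.
  exact: measurable_funX.
pose th := 2 * t ^+ 2 / s.
have th01 : 0 <= th <= 1.
  apply/andP; split; last by rewrite /th ler_pdivrMr // mul1r.
  by rewrite /th divr_ge0 ?(ltW s0) // mulr_ge0 ?sqr_ge0.
have /andP[th0 th1] := th01.
have ie (c : R) : c <= s -> P.-integrable setT (fun w => (expR (c * f w ^+ 2))%:E).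
  move=> cs; apply/integrableP; split; first by apply/measurable_EFinP; exact: mexp.
  apply: le_lt_trans (_ : _ <= 2%:E)%E _; last exact: ltry.
  apply: le_trans fs; apply: ge0_le_integral_EFin; rewrite ?mexp //.
  - exact: measurableT_comp.
  - by move=> w; rewrite ger0_norm ?expR_ge0 // ler_expR ler_wpM2r ?sqr_ge0.
have if1 : P.-integrable setT (fun w => (f w)%:E).
  apply: (@le_integrable _ _ _ _ _ measurableT _ (fun w =>
      ((1 + s^-1) * expR (s * f w ^+ 2))%:E)).
  - exact/measurable_EFinP.
  - move=> w _ /=; rewrite lee_fin.
    have h1 := expR_ge1Dx (s * f w ^+ 2).
    have si : 0 < s^-1 by rewrite invr_gt0.
    have h2 : 0 <= s * f w ^+ 2 by rewrite mulr_ge0 ?sqr_ge0 // ltW.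
    rewrite [leRHS]ger0_norm; last by rewrite mulr_ge0 ?expR_ge0 //; lra.
    have h3 : f w ^+ 2 = s^-1 * (s * f w ^+ 2) by field; lra.
    have h4 : `|f w| <= 1 + f w ^+ 2.
      have := sqr_ge0 (`|f w| - 1); rewrite -(real_normK (num_real (f w))); nra.
    apply: le_trans h4 _.
    apply: (@le_trans _ _ ((1 + s^-1) * (1 + s * f w ^+ 2))).
      have -> : (1 + s^-1) * (1 + s * f w ^+ 2) = 1 + s * f w ^+ 2 + s^-1 +
          s^-1 * (s * f w ^+ 2) by ring.
      by rewrite -h3; lra.
    by rewrite ler_wpM2l //; lra.
  - under eq_fun do rewrite EFinM.
    by apply: integrableZl => //; exact: ie.
apply: (@le_trans _ _ (\int[P]_w ((t * f w)%:E + (expR (2 * t ^+ 2 * f w ^+ 2))%:E))%E).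
  apply: ge0_le_integral_EFin => //.
  - by apply: measurableT_comp => //; exact: measurable_funM.
  - by apply: measurable_funD => //; exact: measurable_funM.
  - by move=> w; apply: le_trans (expR_le_add_sq _) _; rewrite exprMn mulrA.
rewrite integralD //; last 2 first.
- under eq_fun do rewrite EFinM.
  exact: integrableZl.
- exact: ie.
have -> : (\int[P]_w (t * f w)%:E = 0)%E.
  under eq_integral do rewrite EFinM.
  by rewrite integralZl // f0 mule0.
rewrite add0e.
apply: (@le_trans _ _ (\int[P]_w ((1 - th) + th * expR (s * f w ^+ 2))%:E)%E).
  apply: ge0_le_integral_EFin => //.
  - by apply: measurable_funD => //; exact: measurable_funM.
  - move=> w; have -> : 2 * t ^+ 2 * f w ^+ 2 = th * (s * f w ^+ 2) by rewrite /th;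
      field; lra.
    by apply: le_trans (expR_chord _ th01) _; lra.
under eq_integral do rewrite EFinD EFinM.
rewrite ge0_integralD //=; last 3 first.
- by move=> w _; rewrite lee_fin subr_ge0.
- by move=> w _; rewrite -EFinM lee_fin mulr_ge0 // expR_ge0.
- by apply/measurable_EFinP/measurable_funM.
rewrite integral_cst_probability ge0_integralZl_EFin //; last exact/measurable_EFinP.
apply: (@le_trans _ _ ((1 - th)%:E + th%:E * 2%:E)%E).
  by rewrite leeD2l // lee_wpmul2l // lee_fin.
rewrite -EFinM -EFinD lee_fin -/th; apply: le_trans (expR_ge1Dx th); lra.
Qed.

Lemma expR_moment_convex (D : R) (I : eqType) (r : seq I) (w : I -> R)
    (y : I -> T -> R) :
  1 <= D -> (forall i, 0 <= w i) -> \sum_(i <- r) w i <= 1 ->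
  (forall i, measurable_fun setT (y i)) ->
  (forall i, i \in r -> \int[P]_x (expR (y i x))%:E <= D%:E)%E ->
  (\int[P]_x (expR (\sum_(i <- r) w i * y i x))%:E <= D%:E)%E.
Proof.
move=> D1 w0 w1 my hy; set W := \sum_(i <- r) w i.
have mexp i : measurable_fun setT (fun x => expR (y i x)) by exact: measurableT_comp.
apply: (@le_trans _ _ (\int[P]_x ((1 - W)%:E +
    \sum_(i <- r) (w i)%:E * (expR (y i x))%:E))%E).
  apply: (@le_trans _ _ (\int[P]_x ((1 - W) + \sum_(i <- r) w i * expR (y i x))%:E)%E).
    apply: ge0_le_integral_EFin => //.
    - by apply: measurableT_comp => //; apply: measurable_sum => i;
        exact: measurable_funM.
    - by apply: measurable_funD => //; apply: measurable_sum => i;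
        exact: measurable_funM.
    - by move=> x; exact: expR_subconvex.
  by under eq_integral do rewrite EFinD -sumEFin.
have t0 i x : (0 <= (w i)%:E * (expR (y i x))%:E)%E by rewrite -EFinM lee_fin mulr_ge0
    // expR_ge0.
have mt i : measurable_fun setT (fun x => (w i)%:E * (expR (y i x))%:E)%E.
  by apply: measurable_funeM; exact/measurable_EFinP.
rewrite ge0_integralD //; last 3 first.
- by move=> x _; rewrite lee_fin subr_ge0.
- by move=> x _; exact: sume_ge0.
- exact: emeasurable_sum.
rewrite integral_cst_probability ge0_integral_sum //.
apply: (@le_trans _ _ ((1 - W)%:E + \sum_(i <- r) (w i * D)%:E)%E).
  rewrite leeD2l //; rewrite big_seq [leRHS]big_seq; apply: lee_sum => i ir.
  rewrite ge0_integralZl_EFin //; last exact/measurable_EFinP.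
  by rewrite EFinM lee_wpmul2l ?lee_fin // hy.
rewrite sumEFin -EFinD lee_fin -mulr_suml -/W.
have W1 : W <= 1 by [].
nra.
Qed.

Lemma expR_moment_lower (f : T -> R) (M s : R) : measurable_fun setT f ->
  (forall w, 0 <= f w) -> 0 <= s ->
  (\int[P]_w (f w)%:E = 1)%E -> (\int[P]_w (f w ^+ 2)%:E <= M%:E)%E ->
  (\int[P]_w (expR (- s * f w))%:E <= (expR (- s + s ^+ 2 * M))%:E)%E.
Proof.
move=> mf f0 s0 f1 fM.
have m1 : measurable_fun setT (fun w => expR (- s * f w)).
  by apply: measurableT_comp => //; exact: measurable_funM.
have m2 : measurable_fun setT (fun w => f w ^+ 2) by exact: measurable_funX.
have h : (\int[P]_w (expR (- s * f w))%:E + s%:E <= (1 + s ^+ 2 * M)%:E)%E.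
  have -> : s%:E = (\int[P]_w (s%:E * (f w)%:E))%E.
    rewrite ge0_integralZl_EFin //.
    - by rewrite f1 mule1.
    - by move=> w _; rewrite lee_fin.
    - exact/measurable_EFinP.
  rewrite -ge0_integralD //; last 3 first.
  - exact/measurable_EFinP.
  - by move=> w _; rewrite -EFinM lee_fin mulr_ge0.
  - by apply: measurable_funeM; exact/measurable_EFinP.
  apply: (@le_trans _ _ (\int[P]_w (1 + (s ^+ 2)%:E * (f w ^+ 2)%:E))%E).
    apply: ge0_le_integral_EFin.
    - by apply: measurable_funD => //; exact: measurable_funM.
    - by apply: measurable_funD => //; exact: measurable_funM.
    - by move=> w; rewrite addr_ge0 ?expR_ge0 ?mulr_ge0.
    - by move=> w; rewrite mulNr -exprMn expRN_le_quad // mulr_ge0.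
  rewrite ge0_integralD //; last 2 first.
  - by move=> w _; rewrite -EFinM lee_fin mulr_ge0 ?sqr_ge0.
  - by apply: measurable_funeM; exact/measurable_EFinP.
  rewrite integral_cst_probability ge0_integralZl_EFin ?sqr_ge0 //; last 2 first.
  - by move=> w _; rewrite lee_fin sqr_ge0.
  - exact/measurable_EFinP.
  by rewrite EFinD (EFinM (s ^+ 2)) leeD2l // lee_wpmul2l // lee_fin sqr_ge0.
apply: (@le_trans _ _ ((1 + s ^+ 2 * M)%:E - s%:E)%E).
  by rewrite leeBrDr.
rewrite -EFinB lee_fin; have := expR_ge1Dx (- s + s ^+ 2 * M); lra.
Qed.

Lemma fourth_moment_le (f : T -> R) (D s : R) : measurable_fun setT f -> 0 < s ->
  (\int[P]_w (expR (s * f w))%:E <= D%:E)%E ->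
  (\int[P]_w (expR (- s * f w))%:E <= D%:E)%E ->
  (\int[P]_w ((f w ^+ 2) ^+ 2)%:E <= (48 * D / s ^+ 4)%:E)%E.
Proof.
move=> mf s0 h1 h2.
have m c : measurable_fun setT (fun w => expR (c * f w)).
  by apply: measurableT_comp => //; exact: measurable_funM.
have s4 : 0 < s ^+ 4 by rewrite exprn_gt0.
apply: (@le_trans _ _ (\int[P]_w ((24 / s ^+ 4)%:E * ((expR (s * f w))%:E +
    (expR (- s * f w))%:E)))%E).
  apply: ge0_le_integral_EFin.
  - by do 2 apply: measurable_funX.
  - by apply: measurable_funM => //; apply: measurable_funD.
  - by move=> w; exact: sqr_ge0.
  - move=> w; have := fourth_power_le_expR (s * f w); rewrite -mulNr => h.
    rewrite mulrAC ler_pdivlMr //; apply: le_trans h.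
    by have -> : (s * f w) ^+ 4 = (f w ^+ 2) ^+ 2 * s ^+ 4 by ring.
rewrite ge0_integralZl_EFin ?divr_ge0 ?(ltW s4) //; last 2 first.
- by move=> w _; rewrite -EFinD lee_fin addr_ge0 ?expR_ge0.
- by apply: emeasurable_funD; exact/measurable_EFinP.
rewrite ge0_integralD //; try by move=> w _; rewrite lee_fin expR_ge0.
- apply: (@le_trans _ _ ((24 / s ^+ 4)%:E * (D%:E + D%:E))%E).
    by rewrite lee_wpmul2l ?lee_fin ?divr_ge0 ?(ltW s4) // leeD.
  rewrite -EFinD -EFinM lee_fin; lra.
- exact/measurable_EFinP.
- exact/measurable_EFinP.
Qed.
End moments.

(** * Projections in Hilbert space and Ky Fan's inequality *)

Lemma sum_nat_if_lt (R : realType) (k N : nat) (F : nat -> R) :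
  \sum_(0 <= m < N) (if (m < k)%N then 0 else F m) = \sum_(k <= m < N) F m.
Proof.
case: (leqP k N) => kN.
  rewrite (big_cat_nat (leq0n k) kN) //= [X in X + _]big_nat [X in X + _]big1 ?add0r.
    by rewrite big_nat [RHS]big_nat; apply: eq_bigr => m /andP[km _]; rewrite ltnNge km.
  by move=> m /andP[_ ->].
rewrite [RHS]big_geq ?(ltnW kN) // big_nat big1 // => m /andP[_ mN].
by rewrite (ltn_trans mN kN).
Qed.

Section inner_product.
Context (R : realType) (H : completeNormedModType R) (ip : H -> H -> R).
Hypothesis hip : is_inner_product ip.

Lemma ipC x y : ip x y = ip y x. Proof. by have [] := hip. Qed.
Lemma ip_norm x : ip x x = `|x| ^+ 2. Proof. by have [] := hip. Qed.
Lemma ipZDl a x y z : ip (a *: x + y) z = a * ip x z + ip y z.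
Proof. by have [_ h _] := hip; exact: h. Qed.
Lemma ip0l z : ip 0 z = 0.
Proof. by have := ipZDl (- 1) 0 0 z; rewrite scaler0 addr0 mulN1r addNr. Qed.
Lemma ipDl x y z : ip (x + y) z = ip x z + ip y z.
Proof. by rewrite -[x in LHS]scale1r ipZDl mul1r. Qed.
Lemma ipZl a x z : ip (a *: x) z = a * ip x z.
Proof. by rewrite -[a *: x]addr0 ipZDl ip0l addr0. Qed.
Lemma ipBl x y z : ip (x - y) z = ip x z - ip y z.
Proof. by rewrite ipDl -scaleN1r ipZl mulN1r. Qed.
Lemma ip0r z : ip z 0 = 0. Proof. by rewrite ipC ip0l. Qed.
Lemma ipDr x y z : ip z (x + y) = ip z x + ip z y.
Proof. by rewrite ipC ipDl !(ipC z). Qed.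
Lemma ipZr a x z : ip z (a *: x) = a * ip z x.
Proof. by rewrite ipC ipZl (ipC z). Qed.
Lemma ipBr x y z : ip z (x - y) = ip z x - ip z y.
Proof. by rewrite ipC ipBl !(ipC z). Qed.
Lemma ip_suml (I : Type) (r : seq I) (Q : pred I) (F : I -> H) z :
  ip (\sum_(i <- r | Q i) F i) z = \sum_(i <- r | Q i) ip (F i) z.
Proof. by apply: (big_morph (ip ^~ z)) => [x y|]; [exact: ipDl|exact: ip0l]. Qed.
Lemma ip_sumr (I : Type) (r : seq I) (Q : pred I) (F : I -> H) z :
  ip z (\sum_(i <- r | Q i) F i) = \sum_(i <- r | Q i) ip z (F i).
Proof. by rewrite ipC ip_suml; apply: eq_bigr => i _; exact: ipC. Qed.

Lemma sqr_normB x y : `|x - y| ^+ 2 = `|x| ^+ 2 - 2 * ip x y + `|y| ^+ 2.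
Proof. by rewrite -!ip_norm ipBl !ipBr (ipC y x); ring. Qed.

Lemma sqr_normD x y : `|x + y| ^+ 2 = `|x| ^+ 2 + 2 * ip x y + `|y| ^+ 2.
Proof. by rewrite -!ip_norm ipDl !ipDr (ipC y x); ring. Qed.

Lemma sqr_normD_le (x y : H) : `|x + y| ^+ 2 <= 2 * `|x| ^+ 2 + 2 * `|y| ^+ 2.
Proof. by have := sqr_ge0 `|x - y|; rewrite sqr_normB sqr_normD; lra. Qed.

Lemma cauchy_schwarz x y : `|ip x y| <= `|x| * `|y|.
Proof.
have [->|y0] := eqVneq y 0; first by rewrite ip0r !normr0 mulr0.
have ny : 0 < `|y| by rewrite normr_gt0.
rewrite -ler_sqr ?nnegrE ?mulr_ge0 // real_normK ?num_real // exprMn.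
have := sqr_ge0 `|(`|y| ^+ 2) *: x - ip x y *: y|.
rewrite sqr_normB -!ip_norm !(ipZl, ipZr) (ip_norm y) => h.
have {h} : 0 <= `|y| ^+ 2 * (`|y| ^+ 2 * ip x x - ip x y ^+ 2).
  apply: le_trans h _; rewrite le_eqVlt; apply/orP; left; apply/eqP; ring.
rewrite pmulr_rge0 ?exprn_gt0 // subr_ge0 => /le_trans; apply.
by rewrite -ip_norm mulrC.
Qed.

Lemma continuous_ipr z : continuous (ip z).
Proof.
move=> x; apply/cvgrPdist_lt => e e0; near=> y.
rewrite -ipBr; apply: le_lt_trans (cauchy_schwarz _ _) _.
have h : `|x - y| < e / (`|z| + 1).
  near: y; apply: cvgr_dist_lt; first exact: cvg_id.
  by rewrite divr_gt0 // ltr_wpDl.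
apply: (@le_lt_trans _ _ ((`|z| + 1) * `|x - y|)); first by rewrite ler_wpM2r // lerDl.
by rewrite -ltr_pdivlMl ?ltr_wpDl // mulrC.
Unshelve. all: by end_near. Qed.

Definition orthonormal_below (e : nat -> H) (m : nat) :=
  forall i j, (i < m)%N -> (j < m)%N -> ip (e i) (e j) = (i == j)%:R.

Section finite_family.
Variables (e : nat -> H) (m : nat).
Hypothesis oe : orthonormal_below e m.
Local Notation Q := (spectral_projection ip e m).

Lemma ip_spectral_projection_basis i x : (i < m)%N -> ip (e i) (Q x) = ip (e i) x.
Proof.
move=> im; rewrite /spectral_projection ip_sumr (bigD1 (Ordinal im)) //= big1 ?addr0.
  by rewrite /tensor ipZr oe // eqxx mulr1.
move=> j ji; rewrite /tensor ipZr oe //.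
have /negbTE -> : i != j by apply: contra ji => /eqP e1; apply/eqP/val_inj.
by rewrite mulr0.
Qed.

Lemma ip_spectral_projection x y : ip (Q x) y = \sum_(i < m) ip (e i) x * ip (e i) y.
Proof. by rewrite /spectral_projection ip_suml; apply: eq_bigr => i _;
    rewrite ipZl. Qed.

Lemma sqr_norm_spectral_projection x : `|Q x| ^+ 2 = \sum_(i < m) ip (e i) x ^+ 2.
Proof.
rewrite -ip_norm ip_spectral_projection; apply: eq_bigr => i _.
by rewrite ip_spectral_projection_basis.
Qed.

Lemma sqr_norm_sub_spectral_projection x :
  `|x - Q x| ^+ 2 = `|x| ^+ 2 - \sum_(i < m) ip (e i) x ^+ 2.
Proof.
rewrite sqr_normB (ipC x) ip_spectral_projection sqr_norm_spectral_projection.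
under eq_bigr do rewrite -expr2.
ring.
Qed.

Lemma bessel x : \sum_(i < m) ip (e i) x ^+ 2 <= `|x| ^+ 2.
Proof.
by rewrite -subr_ge0 -sqr_norm_sub_spectral_projection sqr_ge0.
Qed.

Lemma norm_sub_spectral_projection_le x : `|x - Q x| ^+ 2 <= `|x| ^+ 2.
Proof.
by rewrite sqr_norm_sub_spectral_projection lerBlDr lerDl sumr_ge0 // => i _;
    exact: sqr_ge0.
Qed.

Lemma continuous_spectral_projection : continuous Q.
Proof.
move=> x; apply: cvg_big => [|j _]; first exact: add_continuous.
by apply: cvgZr_tmp; exact: continuous_ipr.
Qed.

Lemma spectral_projection_linear a x y : Q (a *: x + y) = a *: Q x + Q y.
Proof.
rewrite /spectral_projection scaler_sumr -big_split; apply: eq_bigr => j _ /=.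
by rewrite /tensor ipDr ipZr scalerDl scalerA.
Qed.

Lemma spectral_projectionB x y : Q (x - y) = Q x - Q y.
Proof. by rewrite addrC -scaleN1r spectral_projection_linear scaleN1r addrC. Qed.

End finite_family.

(** A vector that depends on its predecessors is dropped, so that [e] may be
    shorter than [b]. *)
Lemma gram_schmidt (b : nat -> H) (k : nat) : exists m (e : nat -> H),
  [/\ (m <= k)%N, orthonormal_below e m,
     forall i, (i < m)%N -> exists c : nat -> R, e i = \sum_(j < k) c j *: b j &
     forall j, (j < k)%N -> spectral_projection ip e m (b j) = b j].
Proof.
elim: k => [|k [m [e [mk oe span fix_]]]]; first by exists 0%N, (fun=> 0); split.
pose r := b k - spectral_projection ip e m (b k).
have ext i : (i < m)%N -> exists c : nat -> R, e i = \sum_(j < k.+1) c j *: b j.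
  move=> im; have [c cE] := span _ im; exists (fun j => if j == k then 0 else c j).
  rewrite big_ord_recr /= eqxx scale0r addr0 cE; apply: eq_bigr => j _.
  by rewrite ltn_eqF.
have [r0|r0] := eqVneq r 0.
  exists m, e; split => //; first exact: leqW.
  move=> j; rewrite ltnS leq_eqVlt => /predU1P[->|]; last exact: fix_.
  by move/eqP: r0; rewrite subr_eq0 => /eqP.
have re i : (i < m)%N -> ip (e i) r = 0.
  by move=> im; rewrite /r ipBr (ip_spectral_projection_basis oe) // subrr.
pose e' i := if i == m then `|r|^-1 *: r else e i.
have e'E i : (i < m)%N -> e' i = e i by move=> im; rewrite /e' ltn_eqF.
have e'm : e' m = `|r|^-1 *: r by rewrite /e' eqxx.
have nr : `|r| != 0 by rewrite normr_eq0.
have QE x : spectral_projection ip e' m.+1 x =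
    spectral_projection ip e m x + ip (e' m) x *: e' m.
  rewrite /spectral_projection big_ord_recr /=; congr (_ + _).
  by apply: eq_bigr => i _; rewrite e'E.
exists m.+1, e'; split => //.
- move=> i j; rewrite !ltnS (leq_eqVlt i m) (leq_eqVlt j m) =>
    /predU1P[->|im] /predU1P[->|jm].
  + by rewrite eqxx mulr1n e'm ipZl ipZr ip_norm; field.
  + by rewrite e'm e'E // ipZl ipC re // mulr0 gtn_eqF.
  + by rewrite e'm e'E // ipZr re // mulr0 ltn_eqF.
  + by rewrite !e'E // oe.
- move=> i; rewrite ltnS leq_eqVlt => /predU1P[->|im]; last by rewrite e'E //;
    exact: ext.
  have cc (i' : 'I_m) : exists c : nat -> R, e i' =
      \sum_(j < k) c j *: b j by exact: span.
  have [c cE] := choice cc.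
  exists (fun j => `|r|^-1 * (if j ==
      k then 1 else - \sum_(i < m) ip (e i) (b k) * c i j)).
  rewrite e'm big_ord_recr /= eqxx mulr1 {2}/r scalerBr addrC; congr (_ + _).
  rewrite -scalerN /spectral_projection /tensor -sumrN scaler_sumr.
  transitivity (\sum_(i < m) \sum_(j < k) (`|r|^-1 * - (ip (e i) (b k) * c i j)) *: b
      j).
    apply: eq_bigr => i' _; rewrite cE -scaleNr scalerA scaler_sumr -cE.
    by apply: eq_bigr => j _; rewrite scalerA -mulrA mulNr.
  rewrite exchange_big /=; apply: eq_bigr => j _.
  by rewrite ltn_eqF // -scaler_suml -mulr_sumr sumrN.
- move=> j; rewrite ltnS leq_eqVlt => /predU1P[->|jk].
    rewrite QE e'm ipZl scalerA.
    have -> : ip r (b k) = `|r| ^+ 2.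
      have -> : b k = r + spectral_projection ip e m (b k) by rewrite /r subrK.
      rewrite ipDr -ip_norm -[RHS]addr0; congr (_ + _).
      rewrite ipC ip_spectral_projection big1 // => i _.
      by rewrite re // mulr0.
    have -> : `|r|^-1 * `|r| ^+ 2 * `|r|^-1 = 1 by field.
    by rewrite scale1r /r addrC subrK.
  rewrite QE fix_ // (_ : ip (e' m) (b j) = 0) ?scale0r ?addr0 //.
  rewrite e'm ipZl -(fix_ _ jk) ipC ip_spectral_projection big1 ?mulr0 // => i _.
  by rewrite re // mulr0.
Qed.

(** Orthonormalize a basis of the range.  Each [e i] lies in the range, hence is
    fixed by [Q], and symmetry of [Q] identifies the coordinates of [Q x]. *)
Lemma orthogonal_projection_spectral (Q : H -> H) k : orthogonal_projections ip k Q ->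
  exists m (e : nat -> H), [/\ (m <= k)%N, orthonormal_below e m &
    forall x, Q x = spectral_projection ip e m x].
Proof.
move=> [Qlin Qid Qsym [b [_ rQ]]].
pose b' j := if insub j is Some i then b i else 0.
have b'E (i : 'I_k) : b' i = b i by rewrite /b' valK.
have [m [e [mk oe span fix_]]] := gram_schmidt b' k.
exists m, e; split => // x.
have Qe i : (i < m)%N -> Q (e i) = e i.
  move=> im; have [c cE] := span _ im.
  have [y _ <-] : range Q (e i).
    rewrite rQ; exists (fun j : 'I_k => c j); rewrite cE.
    by apply: eq_bigr => j _; rewrite b'E.
  exact: Qid.
have [c QxE] : exists c : 'I_k -> R, Q x = \sum_i c i *: b i.
  by have : range Q (Q x) by []; rewrite rQ.
transitivity (spectral_projection ip e m (Q x)).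
  have lin := spectral_projection_linear e m.
  have lin0 : spectral_projection ip e m 0 = 0.
    by rewrite /spectral_projection big1 // => i _; rewrite /tensor ip0r scale0r.
  have linD : {morph spectral_projection ip e m : y z / y + z}.
    by move=> y z; have := lin 1 y z; rewrite !scale1r.
  rewrite QxE (big_morph _ linD lin0); apply: eq_bigr => i _.
  have := lin (c i) (b i) 0; rewrite !addr0 lin0 addr0 => ->.
  by rewrite -b'E fix_.
by apply: eq_bigr => i _; rewrite /tensor -Qsym Qe.
Qed.

Section basis.
Variable u : nat -> H.
Hypothesis ou : orthonormal_basis ip u.

Lemma orthonormal_basis_below m : orthonormal_below u m.
Proof. by move=> i j _ _; have [] := ou. Qed.

Lemma spectral_projection_orthogonal k :
  orthogonal_projections ip k (spectral_projection ip u k).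
Proof.
have ob := @orthonormal_basis_below k.
have Qu (i : 'I_k) : spectral_projection ip u k (u i) = u i.
  rewrite /spectral_projection (bigD1 i) //= big1 ?addr0.
    by rewrite /tensor ob // eqxx scale1r.
  by move=> j ji; rewrite /tensor ob // val_eqE (negbTE ji) scale0r.
have ipu (c : 'I_k -> R) (i : 'I_k) : ip (u i) (\sum_j c j *: u j) = c i.
  rewrite ip_sumr (bigD1 i) //= big1 ?addr0; first by rewrite ipZr ob // eqxx mulr1.
  by move=> j ji; rewrite ipZr ob // val_eqE eq_sym (negbTE ji) mulr0.
split.
- exact: spectral_projection_linear.
- by move=> x; apply: eq_bigr => i _; rewrite /tensor (ip_spectral_projection_basis ob).
- move=> x y; rewrite ip_spectral_projection (ipC x) ip_spectral_projection.
  by apply: eq_bigr => i _; rewrite mulrC.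
- exists (fun i => u i); split.
    by move=> c c0 i; rewrite -(ipu c i) c0 ip0r.
  apply/seteqP; split => [_ [x _ <-]|_ [c ->]];
      first by exists (fun i : 'I_k => ip (u i) x).
  exists (\sum_i c i *: u i) => //.
  by apply: eq_bigr => i _; rewrite /tensor ipu.
Qed.

Lemma parseval_ip x y : (\sum_(0 <= j < N) ip (u j) x * ip (u j) y) @[N --> \oo] -->
    ip x y.
Proof.
have [_ /(_ y) h] := ou.
have := cvg_comp _ _ h (@continuous_ipr x y).
rewrite (_ : _ \o _ = fun N => \sum_(0 <= j < N) ip (u j) x * ip (u j) y) //.
apply/funext => N /=; rewrite /series /= ip_sumr; apply: eq_bigr => j _.
by rewrite ipZr (ipC x) mulrC.
Qed.

Lemma parseval x : (\sum_(0 <= j < N) ip (u j) x ^+ 2) @[N --> \oo] --> `|x| ^+ 2.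
Proof.
have := @parseval_ip x x; rewrite ip_norm.
by under eq_fun do under eq_bigr do rewrite -expr2.
Qed.

End basis.

Lemma ip_sub_spectral_projection (v : nat -> H) k m x : orthonormal_basis ip v ->
  ip (v m) (x - spectral_projection ip v k x) = if (m < k)%N then 0 else ip (v m) x.
Proof.
move=> ov; rewrite ipBr; case: ltnP => mk.
  by rewrite (ip_spectral_projection_basis (@orthonormal_basis_below _ ov k)) // subrr.
rewrite /spectral_projection ip_sumr big1 ?subr0 // => j _.
rewrite /tensor ipZr; have [-> _] := ov.
by rewrite gtn_eqF ?mulr0 // (leq_trans (ltn_ord j)).
Qed.

(** After subtracting [l k] from every weight, only the indices below [k]
    contribute positively, and there [p j <= 1]. *)
Lemma weighted_sum_le (l p : nat -> R) (k N : nat) :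
  nonincreasing_seq l -> (forall j, 0 <= l j) -> (forall j, 0 <= p j <= 1) ->
  \sum_(0 <= j < N) p j <= k%:R ->
  \sum_(0 <= j < N) l j * p j <= \sum_(0 <= j < k) l j.
Proof.
move=> nl l0 p01 pk.
pose t j := if (j < k)%N then l j - l k else 0.
have t0 j : 0 <= t j by rewrite /t; case: ltnP => // jk; rewrite subr_ge0 nl // ltnW.
apply: (@le_trans _ _ (\sum_(0 <= j < N) (t j + l k * p j))).
  apply: ler_sum => j _; have /andP[p0 p1] := p01 j.
  rewrite /t; case: ltnP => jk.
    have := nl _ _ (ltnW jk). nra.
  have := nl _ _ jk. nra.
rewrite big_split /= -mulr_sumr.
apply: (@le_trans _ _ (\sum_(0 <= j < k) (l j - l k) + l k * k%:R)); last first.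
  by rewrite big_split /= sumrN sumr_const_nat subn0 mulr_natr; lra.
apply: lerD; last by rewrite ler_wpM2l.
apply: (@le_trans _ _ (\sum_(0 <= j < k + N) t j)).
  by rewrite [leRHS](@big_cat_nat _ _ _ N) ?leq_addl //= lerDl sumr_ge0.
rewrite (@big_cat_nat _ _ _ k) ?leq_addr //=
    [X in _ + X]big_nat_cond [X in _ + X]big1 ?addr0; last first.
  by move=> j /andP[/andP[kj _] _]; rewrite /t ltnNge kj.
by rewrite !big_nat; apply: ler_sum => j /andP[_ jk]; rewrite /t jk.
Qed.

(** The quadratic form expands as [\sum_j l j * p j] with
    [p j = \sum_(i < m) ip (e i) (v j) ^+ 2].  Bessel's inequality for [e] gives
    [p j <= 1], and for [v] it bounds the sum of the [p j] by [m]. *)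
Lemma ky_fan (S : H -> H) (l : nat -> R) (v e : nat -> H) (m k : nat) :
  spectral_decomposition ip S l v -> (forall x y, ip (S x) y = ip x (S y)) ->
  (forall j, 0 <= l j) -> orthonormal_below e m -> (m <= k)%N ->
  \sum_(i < m) ip (S (e i)) (e i) <= \sum_(0 <= j < k) l j.
Proof.
move=> [nl ov Sv] Ssym l0 oe mk.
have cv : (\sum_(0 <= j < N) l j * (\sum_(i < m) ip (e i) (v j) ^+ 2)) @[N --> \oo] -->
    \sum_(i < m) ip (S (e i)) (e i).
  rewrite (_ : (fun N => _) = fun N =>
      \sum_(i < m) \sum_(0 <= j < N) ip (v j) (S (e i)) * ip (v j) (e i)).
    by apply: cvg_big => [|i _]; [exact: add_continuous|exact: parseval_ip].
  apply/funext => N; rewrite exchange_big /=; apply: eq_bigr => j _.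
  rewrite mulr_sumr; apply: eq_bigr => i _.
  by rewrite -Ssym Sv ipZl (ipC (v j)); ring.
rewrite -(cvg_lim _ cv) //; apply: limr_le; first by apply/cvg_ex; eexists; exact: cv.
near=> N; apply: weighted_sum_le => //.
  move=> j; rewrite sumr_ge0 => [|i _]; last exact: sqr_ge0.
  apply: le_trans (bessel oe _) _.
  by rewrite -ip_norm; have [-> _] := ov; rewrite eqxx.
rewrite exchange_big /=; apply: (@le_trans _ _ (\sum_(i < m) 1)); last first.
  by rewrite sumr_const card_ord ler_nat.
apply: ler_sum => i _; have <- : `|e i| ^+ 2 = 1 by rewrite -ip_norm oe // eqxx.
rewrite big_mkord; apply: le_trans (bessel (@orthonormal_basis_below _ ov N) (e i)).
by apply: ler_sum => j _; rewrite (ipC (e i)).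
Unshelve. all: by end_near. Qed.

Lemma quadratic_form_span (S : H -> H) (l : nat -> R) (u : nat -> H) (k : nat)
    (c : 'I_k -> R) :
  spectral_decomposition ip S l u -> (forall x y, ip (S x) y = ip x (S y)) ->
  let a := \sum_(j < k) c j *: u j in
  ip (S a) a = \sum_(j < k) l j * c j ^+ 2.
Proof.
move=> [_ ou Su] Ssym a; rewrite {2}/a ip_sumr; apply: eq_bigr => j _.
rewrite ipZr Ssym Su ipZr /a ip_suml (bigD1 j) //= big1 ?addr0.
  by rewrite ipZl (orthonormal_basis_below ou (ltn_ord j) (ltn_ord j)) eqxx mulr1n;
      ring.
move=> i ij; rewrite ipZl (orthonormal_basis_below ou (ltn_ord i) (ltn_ord j)).
by rewrite val_eqE (negbTE ij) mulr0.
Qed.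

End inner_product.

(** * Empirical risk *)

Section sample.
Context (R : realType) (H : completeNormedModType R) (ip : H -> H -> R).
Hypothesis hip : is_inner_product ip.
Variables (n : nat) (x : 'I_n -> H) (hl : nat -> R) (hu u : nat -> H) (k : nat).
Hypothesis n1 : (1 <= n)%N.
Hypothesis hsd : spectral_decomposition ip (sample_covariance ip x) hl hu.
Hypothesis ou : orthonormal_basis ip u.
Local Notation Q := (spectral_projection ip hu k).
Local Notation Pk := (spectral_projection ip u k).

Let n0 : 0 < n%:R :> R. Proof. by rewrite ltr0n. Qed.

Lemma ip_sample_covariance a b :
  ip (sample_covariance ip x a) b = n%:R^-1 * \sum_i ip (x i) a * ip (x i) b.
Proof. by rewrite /sample_covariance (ipZl hip) (ip_suml hip); congr (_ * _);
    apply: eq_bigr => i _; rewrite (ipZl hip). Qed.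

Lemma sample_covariance_sym a b :
  ip (sample_covariance ip x a) b = ip a (sample_covariance ip x b).
Proof.
rewrite (ipC hip a) !ip_sample_covariance; congr (_ * _).
by apply: eq_bigr => i _; rewrite mulrC.
Qed.

Lemma empirical_risk_spectral_projection (e : nat -> H) : orthonormal_below ip e k ->
  \sum_i `|x i - spectral_projection ip e k (x i)| ^+ 2 =
  \sum_i `|x i| ^+ 2 - n%:R * \sum_(j < k) ip (sample_covariance ip x (e j)) (e j).
Proof.
move=> oe; under eq_bigr do rewrite (sqr_norm_sub_spectral_projection hip oe).
rewrite sumrB; congr (_ - _); rewrite exchange_big mulr_sumr /=; apply: eq_bigr => j _.
rewrite ip_sample_covariance mulrA divff ?gt_eqF // mul1r.
by apply: eq_bigr => i _; rewrite (ipC hip (x i)) expr2.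
Qed.

(** Ky Fan's inequality for the sample covariance: no [k] orthonormal vectors
    capture more of the sample than its leading eigenvectors. *)
Lemma empirical_risk_minimizer :
  \sum_i `|x i - Q (x i)| ^+ 2 <= \sum_i `|x i - Pk (x i)| ^+ 2.
Proof.
have [_ ohu Shu] := hsd.
have ob v (ov : orthonormal_basis ip v) := @orthonormal_basis_below _ _ _ v ov k.
rewrite (empirical_risk_spectral_projection (ob _ ohu)).
rewrite (empirical_risk_spectral_projection (ob _ ou)).
rewrite lerD2l lerN2 ler_pM2l //.
have lE j : hl j = ip (sample_covariance ip x (hu j)) (hu j).
  by rewrite Shu (ipZl hip); have [-> _] := ohu; rewrite eqxx mulr1.
have hl0 j : 0 <= hl j.
  rewrite lE ip_sample_covariance mulr_ge0 ?invr_ge0 ?(ltW n0) // sumr_ge0 // => i _.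
  by rewrite -expr2 sqr_ge0.
apply: le_trans (ky_fan hip hsd sample_covariance_sym hl0 (ob _ ou) (leqnn k)) _.
by rewrite big_mkord le_eqVlt; apply/orP; left; apply/eqP; apply: eq_bigr => j _.
Qed.

(** The hypothesis says that the sample second moments of the first [k]
    normalized coordinates are bounded below by [c].  Applied to the coordinates
    of [hu m], it bounds the [m]-th term by the average of
    [ip (hu m) (Pk (x i)) ^+ 2].  Since [Pk (x i)] is [x i] minus its residual,
    Bessel's inequality over [m >= k] leaves the empirical risks of [Q] and of
    [Pk], and the former is the smaller. *)
Lemma excess_risk_le (c : R) (l : nat -> R) : 0 < c -> (forall j, 0 < l j) ->
  (forall v : 'I_k -> R, c * \sum_j v j ^+ 2 <=
     n%:R^-1 * \sum_i (\sum_(j < k) (Num.sqrt (l j))^-1 * ip (x i) (u j) * v j) ^+ 2) ->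
  forall N, \sum_(k <= m < N) \sum_(j < k) l j * ip (u j) (hu m) ^+ 2 <=
    4 / (c * n%:R) * \sum_i `|x i - Pk (x i)| ^+ 2.
Proof.
move=> c0 l0 hc N.
have [_ ohu Shu] := hsd.
have ob v (ov : orthonormal_basis ip v) M := @orthonormal_basis_below _ _ _ v ov M.
pose y i := x i - Q (x i); pose z i := x i - Pk (x i).
have step m : (k <= m)%N -> \sum_(j < k) l j * ip (u j) (hu m) ^+ 2 <=
    (c * n%:R)^-1 * \sum_i (2 * ip (hu m) (y i) ^+ 2 + 2 * ip (hu m) (z i) ^+ 2).
  move=> km; have := hc (fun j => Num.sqrt (l j) * ip (u j) (hu m)).
  have -> : \sum_(j < k) (Num.sqrt (l j) * ip (u j) (hu m)) ^+ 2 =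
      \sum_(j < k) l j * ip (u j) (hu m) ^+ 2.
    by apply: eq_bigr => j _; rewrite exprMn sqr_sqrtr // ltW.
  set A := \sum_(j < k) _ => h.
  have {}h : A * (c * n%:R) <=
      \sum_i (\sum_(j < k) (Num.sqrt (l j))^-1 * ip (x i) (u j) *
      (Num.sqrt (l j) * ip (u j) (hu m))) ^+ 2.
    by move: h; rewrite mulrC [leRHS]mulrC ler_pdivlMr // mulrA.
  rewrite [leRHS]mulrC ler_pdivlMr ?mulr_gt0 //; apply: le_trans h _.
  apply: ler_sum => i _.
  have -> : \sum_(j < k) (Num.sqrt (l j))^-1 * ip (x i) (u j)
      * (Num.sqrt (l j) * ip (u j) (hu m)) =
     ip (hu m) (y i) - ip (hu m) (z i).
    rewrite [ip (hu m) (y i)](ip_sub_spectral_projection hip) // ltnNge km /=.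
    rewrite /z (ipBr hip) opprB addrC subrK (ipC hip) (ip_spectral_projection hip).
    apply: eq_bigr => j _; rewrite (ipC hip (x i)).
    have : Num.sqrt (l j) != 0 by rewrite gt_eqF // sqrtr_gt0.
    by move=> sq; field.
  have := sqr_ge0 (ip (hu m) (y i) + ip (hu m) (z i)); nra.
apply: (@le_trans _ _ (\sum_(k <= m < N) (c * n%:R)^-1 * \sum_i
    (2 * ip (hu m) (y i) ^+ 2 + 2 * ip (hu m) (z i) ^+ 2))).
  by rewrite !big_nat; apply: ler_sum => m /andP[km _]; exact: step.
have bes w : \sum_(k <= m < N) ip (hu m) w ^+ 2 <= `|w| ^+ 2.
  apply: le_trans (bessel hip (ob _ ohu N) w).
  rewrite -(big_mkord xpredT (fun m => ip (hu m) w ^+ 2)).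
  case: (leqP k N) => kN.
    by rewrite [leRHS](big_cat_nat (leq0n k) kN) //= lerDr sumr_ge0 // => m _;
        exact: sqr_ge0.
  by rewrite [leLHS]big_geq ?(ltnW kN) // sumr_ge0 // => m _; exact: sqr_ge0.
have cn : 0 < (c * n%:R)^-1 by rewrite invr_gt0 mulr_gt0.
rewrite -mulr_sumr exchange_big /=.
apply: (@le_trans _ _ ((c * n%:R)^-1 * \sum_i (2 * `|y i| ^+ 2 + 2 * `|z i| ^+ 2))).
  rewrite ler_pM2l //; apply: ler_sum => i _.
  by rewrite big_split /= -!mulr_sumr; apply: lerD; rewrite ler_pM2l.
have := empirical_risk_minimizer; rewrite -/(y _) -/(z _) => h.
rewrite big_split /= -!mulr_sumr mulrAC [leRHS]mulrC ler_pM2l //.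
rewrite /y /z; lra.
Qed.
End sample.

(** * Reconstruction error *)

Section measurability.
Context (R : realType) (H : completeNormedModType R).

Lemma continuous_borel_measurable (f : H -> R) : continuous f ->
  measurable_fun setT (f : borel_of H -> R).
Proof.
move=> cf; apply: (measurability _ (RGenOInfty.measurableE R)).
move=> _ [_ [a ->] <-]; rewrite setTI; apply: sub_sigma_algebra.
by move/continuousP : cf; apply; exact: interval_open.
Qed.
End measurability.

Section parseval_integral.
Context (R : realType) (H : completeNormedModType R) (ip : H -> H -> R).
Hypothesis hip : is_inner_product ip.
Context d (T : measurableType d) (P : probability T R).
Variables (v : nat -> H) (Z : T -> H).
Hypothesis ov : orthonormal_basis ip v.
Hypothesis mZ : forall m, measurable_fun setT (fun w => ip (v m) (Z w)).

Let mZ2 m : measurable_fun setT (fun w => ip (v m) (Z w) ^+ 2).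
Proof. exact: measurable_funX. Qed.

Let g N w := \sum_(0 <= m < N) ip (v m) (Z w) ^+ 2.

Let g_nd w m n : (m <= n)%N -> g m w <= g n w.
Proof.
move=> mn; rewrite /g (big_cat_nat (leq0n m) mn) //= lerDl.
by apply: sumr_ge0 => i _; exact: sqr_ge0.
Qed.

Lemma integral_parseval : (\int[P]_w (`|Z w| ^+ 2)%:E =
  limn (fun N => \sum_(0 <= m < N) \int[P]_w (ip (v m) (Z w) ^+ 2)%:E))%E.
Proof.
transitivity (limn (fun N => \int[P]_w (g N w)%:E)%E).
  rewrite -monotone_convergence //.
  - apply: eq_integral => w _; apply/esym/cvg_lim => //.
    apply: cvg_EFin; first by near=> n.
    exact: (parseval hip ov).
  - by move=> N; apply/measurable_EFinP; exact: measurable_sum.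
  - by move=> N w _; rewrite lee_fin sumr_ge0 // => i _; exact: sqr_ge0.
  - by move=> w _ m n mn; rewrite lee_fin; exact: g_nd.
congr (limn _); apply/funext => N.
under eq_integral do rewrite -sumEFin.
rewrite ge0_integral_sum // => m; first exact/measurable_EFinP.
by move=> w _; rewrite lee_fin sqr_ge0.
Unshelve. all: by end_near. Qed.

Let S_nd : nondecreasing_seq (fun N =>
    \sum_(0 <= m < N) \int[P]_w (ip (v m) (Z w) ^+ 2)%:E)%E.
Proof.
apply/nondecreasing_seqP => N; rewrite big_nat_recr //= leeDl //.
by apply: integral_ge0 => w _; rewrite lee_fin sqr_ge0.
Qed.

Lemma integral_parseval_le (B : \bar R) :
  (forall N, \sum_(0 <= m < N) \int[P]_w (ip (v m) (Z w) ^+ 2)%:E <= B)%E ->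
  (\int[P]_w (`|Z w| ^+ 2)%:E <= B)%E.
Proof.
move=> h; rewrite integral_parseval; apply: lime_le; last by near=> N; exact: h.
exact: ereal_nondecreasing_is_cvgn.
Unshelve. all: by end_near. Qed.

Lemma integral_parseval_ge N :
  (\sum_(0 <= m < N) \int[P]_w (ip (v m) (Z w) ^+ 2)%:E <=
      \int[P]_w (`|Z w| ^+ 2)%:E)%E.
Proof.
rewrite integral_parseval.
rewrite (cvg_lim _ (ereal_nondecreasing_cvgn S_nd)) //.
by apply: ereal_sup_ubound; exists N.
Qed.
End parseval_integral.

Section population.
Context (R : realType) (H : completeNormedModType R) (ip : H -> H -> R).
Hypothesis hip : is_inner_product ip.
Context d0 (T : measurableType d0) (P : probability T R) (X : {RV P >-> borel_of H}).
Variables (Sigma : H -> H) (l : nat -> R) (u : nat -> H).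
Hypothesis cov : is_covariance ip P X Sigma.
Hypothesis sd : spectral_decomposition ip Sigma l u.
Hypothesis l0 : forall j, 0 < l j.

Let ou : orthonormal_basis ip u. Proof. by have [] := sd. Qed.
Let ob m : orthonormal_below ip u m. Proof. exact: orthonormal_basis_below. Qed.

Lemma measurable_continuous_comp (f : H -> R) : continuous f ->
  measurable_fun setT (fun w => f (X w)).
Proof.
move=> cf; apply: (measurableT_comp (continuous_borel_measurable cf)).
exact: measurable_funP.
Qed.

Lemma reconstruction_errorE (Q : H -> H) :
  reconstruction_error P X Q = (\int[P]_w (`|X w - Q (X w)| ^+ 2)%:E)%E.
Proof. by rewrite /reconstruction_error unlock. Qed.

Lemma integral_ip2 a : (\int[P]_w (ip (X w) a ^+ 2)%:E = (ip (Sigma a) a)%:E)%E.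
Proof.
have := cov a a; rewrite unlock => <-; apply: eq_integral => w _.
by rewrite /tensor (ipZl hip) expr2.
Qed.

Lemma covariance_sym x y : ip (Sigma x) y = ip x (Sigma y).
Proof.
apply: EFin_inj; rewrite -(cov x y) (ipC hip x) -(cov y x) unlock.
by apply: eq_integral => w _; rewrite /tensor !(ipZl hip) mulrC.
Qed.

Lemma measurable_sqr_norm_sub_proj (e : nat -> H) m :
  measurable_fun setT (fun w => `|X w - spectral_projection ip e m (X w)| ^+ 2).
Proof.
apply: measurable_funX.
apply: (measurable_continuous_comp (f := fun x =>
    `|x - spectral_projection ip e m x|)) => x.
apply: cvg_norm; apply: cvgB; first exact: cvg_id.
exact: continuous_spectral_projection.
Qed.

Lemma measurable_ip_sqr_sum (e : nat -> H) m :
   measurable_fun setT (fun w => \sum_(i < m) ip (e i) (X w) ^+ 2).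
Proof.
apply: measurable_sum => i; apply: measurable_funX.
by apply: measurable_continuous_comp; exact: continuous_ipr.
Qed.

(** Pythagoras.  The right-hand side is common to all projections, so that their
    risks compare through the captured variances. *)
Lemma risk_spectral_projection (e : nat -> H) m : orthonormal_below ip e m ->
  (reconstruction_error P X (spectral_projection ip e m) +
    (\sum_(i < m) ip (Sigma (e i)) (e i))%:E = \int[P]_w (`|X w| ^+ 2)%:E)%E.
Proof.
move=> oe; rewrite reconstruction_errorE.
have -> : ((\sum_(i < m) ip (Sigma (e i)) (e i))%:E =
    \int[P]_w (\sum_(i < m) ip (e i) (X w) ^+ 2)%:E)%E.
  under eq_integral do rewrite -sumEFin.
  rewrite ge0_integral_sum //.
  - rewrite -sumEFin; apply: eq_bigr => i _; rewrite -integral_ip2.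
    by apply: eq_integral => w _; rewrite (ipC hip).
  - move=> i; apply/measurable_EFinP/measurable_funX.
    by apply: measurable_continuous_comp; exact: continuous_ipr.
  - by move=> i w _; rewrite lee_fin sqr_ge0.
rewrite -ge0_integralD //.
- apply: eq_integral => w _; rewrite -EFinD; congr EFin.
  by rewrite (sqr_norm_sub_spectral_projection hip oe) subrK.
- by apply/measurable_EFinP; exact: measurable_sqr_norm_sub_proj.
- by move=> w _; rewrite lee_fin sumr_ge0 // => i _; exact: sqr_ge0.
- by apply/measurable_EFinP; exact: measurable_ip_sqr_sum.
Qed.

(** Every competitor is the projection onto at most [k] orthonormal vectors, and
    by Ky Fan's inequality these capture at most the [k] largest eigenvalues. *)
Lemma risk_minimizer k : is_minimum
  [set reconstruction_error P X Q | Q in orthogonal_projections ip k]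
  (reconstruction_error P X (spectral_projection ip u k)).
Proof.
split.
  by exists (spectral_projection ip u k) => //; exact: spectral_projection_orthogonal.
move=> _ [Q hQ <-].
have [m [e [mk oe QE]]] := orthogonal_projection_spectral hip hQ.
have -> : Q = spectral_projection ip e m by exact/funext.
have h1 := risk_spectral_projection oe.
have h2 := risk_spectral_projection (@ob k).
have kf := ky_fan hip sd covariance_sym (fun j => ltW (l0 j)) oe mk.
have e2 : \sum_(i < k) ip (Sigma (u i)) (u i) = \sum_(0 <= j < k) l j.
  rewrite big_mkord; apply: eq_bigr => j _; have [_ [ooo _] ->] := sd.
  by rewrite (ipZl hip) ooo eqxx mulr1.
rewrite e2 -h1 in h2.
rewrite -(@leeD2rE _ (\sum_(0 <= j < k) l j)%:E) // h2.
by rewrite leeD2l // lee_fin.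
Qed.

Let coef k m : (\int[P]_w (ip (u m) (X w - spectral_projection ip u k (X w)) ^+ 2)%:E
   = (if (m < k)%N then 0 else l m)%:E)%E.
Proof.
case: ifPn => mk.
  rewrite (eq_integral (fun=> 0%:E)) ?integral0 // => w _.
  by rewrite (ip_sub_spectral_projection hip) // mk expr0n.
have := integral_ip2 (u m); have [_ [ooo _] ->] := sd.
rewrite (ipZl hip) ooo eqxx mulr1 => <-; apply: eq_integral => w _.
by rewrite (ip_sub_spectral_projection hip) // (negbTE mk) (ipC hip).
Qed.

Let mcoef k m : measurable_fun setT (fun w =>
    ip (u m) (X w - spectral_projection ip u k (X w))).
Proof.
rewrite (_ : (fun _ => _) = fun w => if (m < k)%N then 0 else ip (u m) (X w)).
  by case: ltnP => _ //; apply: measurable_continuous_comp; exact: continuous_ipr.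
by apply/funext => w; exact: (ip_sub_spectral_projection hip).
Qed.

Lemma risk_tail_le k (B : R) : (forall N, \sum_(k <= j < N) l j <= B) ->
  (reconstruction_error P X (spectral_projection ip u k) <= B%:E)%E.
Proof.
move=> h; rewrite reconstruction_errorE;
    apply: (integral_parseval_le hip ou (mcoef k)) => N.
by under eq_bigr do rewrite coef; rewrite sumEFin sum_nat_if_lt lee_fin.
Qed.

Lemma risk_tail_ge k N : ((\sum_(k <= j < N) l j)%:E <=
  reconstruction_error P X (spectral_projection ip u k))%E.
Proof.
rewrite reconstruction_errorE; have := integral_parseval_ge hip P ou (mcoef k) N.
by under eq_bigr do rewrite coef; rewrite sumEFin sum_nat_if_lt.
Qed.

(** [X] is the sum of [Y = Pk X] and of its residual, which costs the first term.
    By Parseval the remaining [E |Y - Q Y|^2] is a sum over [m >= k] of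
    variances of [Y] in the directions [v m], and these are the inner sums. *)
Lemma risk_le_excess (v : nat -> H) k (B : R) : orthonormal_basis ip v ->
  (forall N, \sum_(k <= m < N) \sum_(j < k) l j * ip (u j) (v m) ^+ 2 <= B) ->
  (reconstruction_error P X (spectral_projection ip v k) <=
   2%:E * reconstruction_error P X (spectral_projection ip u k) + (2 * B)%:E)%E.
Proof.
move=> ov hB; rewrite !reconstruction_errorE.
pose Pk := spectral_projection ip u k; pose Q := spectral_projection ip v k.
pose Y w := Pk (X w).
have obv := @orthonormal_basis_below _ _ _ _ ov k.
have mY : measurable_fun setT (fun w => `|Y w - Q (Y w)| ^+ 2).
  apply: measurable_funX.
  apply: (measurable_continuous_comp (f := fun x => `|Pk x - Q (Pk x)|)) => x.
  have cP : Pk y @[y --> x] --> Pk x by exact: continuous_spectral_projection.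
  apply: cvg_norm; apply: cvgB; first exact: cP.
  apply: (cvg_comp _ _ cP); exact: continuous_spectral_projection.
have tele (a p q q' : H) : a - q = a - p - (q - q') + (p - q').
  rewrite opprB (_ : a - p + (q' - q) = a - q - (p - q')) ?subrK //.
  by rewrite opprB addrACA [RHS]addrACA (addrC (- p)).
have ipY m w : ip (v m) (Y w) = ip (X w) (\sum_(j < k) ip (u j) (v m) *: u j).
  rewrite (ipC hip) (ip_spectral_projection hip) (ip_sumr hip).
  by apply: eq_bigr => j _; rewrite (ipZr hip) (ipC hip (X w)) mulrC.
have hY : (\int[P]_w (`|Y w - Q (Y w)| ^+ 2)%:E <= B%:E)%E.
  have mc m : measurable_fun setT (fun w => ip (v m) (Y w - Q (Y w))).
    rewrite (_ : (fun _ => _) = fun w =>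
        if (m < k)%N then 0 else ip (X w) (\sum_(j < k) ip (u j) (v m) *: u j)).
      case: ltnP => _ //.
      under eq_fun do rewrite (ipC hip).
      by apply: measurable_continuous_comp; exact: continuous_ipr.
    by apply/funext => w; rewrite (ip_sub_spectral_projection hip) // ipY.
  apply: (integral_parseval_le hip ov mc) => N.
  have cE m : (\int[P]_w (ip (v m) (Y w - Q (Y w)) ^+ 2)%:E
     = (if (m < k)%N then 0 else \sum_(j < k) l j * ip (u j) (v m) ^+ 2)%:E)%E.
    rewrite -(quadratic_form_span hip (fun j : 'I_k =>
        ip (u j) (v m)) sd covariance_sym).
    case: ifPn => mk.
      rewrite (eq_integral (fun=> 0%:E)) ?integral0 // => w _.
      by rewrite (ip_sub_spectral_projection hip) // mk expr0n.
    rewrite -integral_ip2; apply: eq_integral => w _.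
    by rewrite (ip_sub_spectral_projection hip) // (negbTE mk) ipY.
  under eq_bigr do rewrite cE.
  by rewrite sumEFin (sum_nat_if_lt k N (fun m =>
      \sum_(j < k) l j * ip (u j) (v m) ^+ 2)) lee_fin.
apply: (@le_trans _ _ (\int[P]_w (2%:E * (`|X w - Pk (X w)| ^+ 2)%:E +
    2%:E * (`|Y w - Q (Y w)| ^+ 2)%:E))%E).
  apply: ge0_le_integral_EFin.
  - exact: measurable_sqr_norm_sub_proj.
  - apply: measurable_funD; apply: measurable_funM => //;
      exact: measurable_sqr_norm_sub_proj.
  - by move=> w; exact: sqr_ge0.
  - move=> w; have -> : X w - Q (X w) = ((X w - Pk (X w)) - Q (X w - Pk (X w))) +
      (Y w - Q (Y w)).
      by rewrite /Q spectral_projectionB // -/Q /Y; exact: tele.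
    apply: le_trans (sqr_normD_le hip _ _) _; rewrite lerD2r ler_pM2l //.
    exact: (norm_sub_spectral_projection_le hip obv).
have m1 : measurable_fun setT (fun w => (`|X w - Pk (X w)| ^+ 2)%:E).
  by apply/measurable_EFinP; exact: measurable_sqr_norm_sub_proj.
have m2 : measurable_fun setT (fun w => (`|Y w - Q (Y w)| ^+ 2)%:E).
  exact/measurable_EFinP.
have p1 w : (0 <= (`|X w - Pk (X w)| ^+ 2)%:E)%E by rewrite lee_fin sqr_ge0.
have p2 w : (0 <= (`|Y w - Q (Y w)| ^+ 2)%:E)%E by rewrite lee_fin sqr_ge0.
rewrite ge0_integralD //=.
- by rewrite !ge0_integralZl_EFin // EFinM leeD2l // lee_wpmul2l.
- exact: measurable_funeM.
- exact: measurable_funeM.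
Qed.

End population.

(** * Independent sub-Gaussian coefficients *)

Section subgaussian_design.
Context (R : realType) (H : completeNormedModType R) (ip : H -> H -> R).
Hypothesis hip : is_inner_product ip.
Context d0 (T : measurableType d0) (P : probability T R) (X : {RV P >-> borel_of H}).
Variables (Sigma : H -> H) (l : nat -> R) (u : nat -> H) (L : R).
Hypothesis L0 : 0 < L.
Hypothesis cX : centered ip P X.
Hypothesis cov : is_covariance ip P X Sigma.
Hypothesis sd : spectral_decomposition ip Sigma l u.
Hypothesis l0 : forall j, 0 < l j.
Local Notation eta := (KL_coefficient ip X l u).
Hypothesis ind : independent_family P eta.
Hypothesis hpsi : (ereal_sup [set psi2_norm P (eta j) | j in setT] <= L%:E)%E.

Let ou : orthonormal_basis ip u. Proof. by have [] := sd. Qed.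
Let s : R := (4 * expR 1 * L ^+ 2)^-1.
Let s0 : 0 < s.
Proof. by rewrite /s invr_gt0 !mulr_gt0 ?expR_gt0 // exprn_gt0. Qed.

Lemma measurable_eta j : measurable_fun setT (eta j).
Proof.
rewrite /KL_coefficient; apply: measurable_funM => //.
under eq_fun do rewrite (ipC hip).
by apply: measurable_continuous_comp; exact: continuous_ipr.
Qed.

Lemma expR_eta_sq j : (\int[P]_w (expR (s * eta j w ^+ 2))%:E <= 2%:E)%E.
Proof.
apply: psi2_norm_expR_sq => //; first exact: measurable_eta.
by apply: le_trans hpsi; apply: ereal_sup_ubound; exists j.
Qed.

Lemma mean_eta j : (\int[P]_w (eta j w)%:E = 0)%E.
Proof.
have := cX ((Num.sqrt (l j))^-1 *: u j); rewrite unlock => <-.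
by apply: eq_integral => w _; rewrite (ipZr hip).
Qed.

Section direction.
Variables (k : nat) (v : nat -> R).
Hypothesis v1 : \sum_(j < k) v j ^+ 2 = 1.

Let vk j := if (j < k)%N then v j else 0.
Let vk1 j : vk j ^+ 2 <= 1.
Proof.
rewrite /vk; case: ltnP => jk; last by rewrite expr0n.
rewrite -v1 (bigD1 (Ordinal jk)) //= lerDl.
by apply: sumr_ge0 => i _; exact: sqr_ge0.
Qed.

Let W w := \sum_(j < k) v j * eta j w.

Let mW : measurable_fun setT W.
Proof. by apply: measurable_sum => j; apply: measurable_funM => //;
    exact: measurable_eta. Qed.

(** Independence factorizes the expectation.  Each [v j] is at most one in
    absolute value, so that [expR_moment_subgaussian] applies to every factor,
    and the exponents [v j ^+ 2] add up to one. *)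
Lemma expR_direction (t : R) : 2 * t ^+ 2 = s ->
  (\int[P]_w (expR (t * W w))%:E <= (expR 1)%:E)%E.
Proof.
move=> ts.
have m1 j : (\int[P]_w (expR (t * vk j * eta j w))%:E <= (expR (vk j ^+ 2))%:E)%E.
  have h : 2 * (t * vk j) ^+ 2 <= s by rewrite exprMn mulrA ts ger_pMr.
  apply: le_trans (expR_moment_subgaussian (measurable_eta j) s0 h (mean_eta j)
      (expR_eta_sq j)) _.
  rewrite exprMn mulrA ts le_eqVlt; apply/orP; left; apply/eqP; congr (expR _)%:E;
      field.
  by rewrite gt_eqF.
have -> : (\int[P]_w (expR (t * W w))%:E =
    \int[P]_w (\prod_(j <- index_iota 0 k) expR (t * vk j * eta j w))%:E)%E.
  apply: eq_integral => w _; rewrite -expR_sum big_mkord /W mulr_sumr;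
      congr (expR _)%:E.
  by apply: eq_bigr => j _; rewrite /vk ltn_ord mulrA.
rewrite (@independent_integral_prod _ _ _ _ _ _ _ eta (fun j x =>
    expR (t * vk j * x))) //.
- apply: le_trans (@lee_prode _ _ _ _ (fun j => expR (vk j ^+ 2)) _) _.
    move=> j; rewrite m1 andbT integral_ge0 // => w _; by rewrite lee_fin expR_ge0.
  rewrite -expR_sum lee_fin ler_expR big_mkord -v1 le_eqVlt; apply/orP; left; apply/eqP.
  by apply: eq_bigr => j _; rewrite /vk ltn_ord.
- exact: measurable_eta.
- by move=> j; apply: measurableT_comp => //; exact: measurable_funM.
- by move=> j; apply: le_lt_trans (m1 j) _; exact: ltry.
- exact: iota_uniq.
Qed.

Lemma direction_ip w : W w = ip (X w) (\sum_(j < k) (v j / Num.sqrt (l j)) *: u j).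
Proof.
rewrite (ip_sumr hip); apply: eq_bigr => j _.
by rewrite (ipZr hip) /KL_coefficient mulrA.
Qed.

Lemma second_moment_direction : (\int[P]_w (W w ^+ 2)%:E = 1)%E.
Proof.
under eq_integral do rewrite direction_ip.
rewrite (integral_ip2 hip cov).
rewrite (quadratic_form_span hip (fun j : 'I_k => v j / Num.sqrt (l j)) sd
    (covariance_sym hip cov)).
rewrite -v1; congr EFin; apply: eq_bigr => j _.
by rewrite expr_div_n sqr_sqrtr ?(ltW (l0 j)) // mulrC divfK // gt_eqF.
Qed.

(** [W ^+ 2] has mean one, and the exponential moments of [W] bound the second
    moment of [W ^+ 2]. *)
Lemma expR_direction_sq (r : R) : 0 <= r ->
  (\int[P]_w (expR (- r * W w ^+ 2))%:E <=
      (expR (- r + r ^+ 2 * (192 * expR 1 / s ^+ 2)))%:E)%E.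
Proof.
move=> r0; apply: expR_moment_lower => //.
- exact: measurable_funX.
- by move=> w; exact: sqr_ge0.
- exact: second_moment_direction.
(* 2 t^2 = s, hence 48 e / t^4 = 192 e / s^2. *)
pose t := Num.sqrt (s / 2).
have s2 : 0 < s / 2 by rewrite divr_gt0.
have tE : t ^+ 2 = s / 2 by rewrite sqr_sqrtr // ltW.
have t0 : 0 < t by rewrite sqrtr_gt0.
apply: le_trans (@fourth_moment_le _ _ _ _ _ (expR 1) t mW t0 _ _) _.
- by apply: expR_direction; rewrite tE; field.
- by apply: expR_direction; rewrite sqrrN tE; field.
rewrite lee_fin le_eqVlt; apply/orP; left; apply/eqP.
have -> : t ^+ 4 = (t ^+ 2) ^+ 2 by rewrite -exprM.
by rewrite tE; field; rewrite gt_eqF.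
Qed.

End direction.

(** The average of the squares inherits their exponential moment by convexity. *)
Lemma expR_head (k : nat) : (0 < k)%N ->
  (\int[P]_w (expR (s / k%:R * \sum_(j < k) eta j w ^+ 2))%:E <= (expR 1)%:E)%E.
Proof.
move=> k0; have k0' : 0 < k%:R :> R by rewrite ltr0n.
apply: (@le_trans _ _ 2%:E); last by rewrite lee_fin expR1_ge2.
have -> : (\int[P]_w (expR (s / k%:R * \sum_(j < k) eta j w ^+ 2))%:E =
    \int[P]_w (expR (\sum_(j < k) k%:R^-1 * (s * eta j w ^+ 2)))%:E)%E.
  apply: eq_integral => w _; rewrite mulr_sumr; congr (expR _)%:E.
  by apply: eq_bigr => j _; ring.
have := @expR_moment_convex R _ T P 2 'I_k (index_enum _) (fun=> k%:R^-1) (fun j w =>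
    s * eta j w ^+ 2).
apply => //; first by rewrite ler1n.
- by rewrite sumr_const card_ord -[leLHS]mulr_natl divff // gt_eqF.
- by move=> j; apply: measurable_funM => //; apply: measurable_funX;
    exact: measurable_eta.
- by move=> j _; exact: expR_eta_sq.
Qed.

(** Divided by [tau], the squared residual is a combination of the
    [eta j ^+ 2], [j >= k], with weights [l j / tau] of total mass at most one. *)
Lemma expR_tail (k : nat) (tau : R) : 0 < tau ->
    (forall N, \sum_(k <= j < N) l j <= tau) ->
  (\int[P]_w (expR (s / tau * `|X w - spectral_projection ip u k (X w)| ^+ 2))%:E <=
      (expR 1)%:E)%E.
Proof.
move=> tau0 htau.
apply: (@le_trans _ _ 2%:E); last by rewrite lee_fin expR1_ge2.
pose w_ m := if (m < k)%N then 0 else l m / tau.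
pose y m w := s * eta m w ^+ 2.
pose g N w := \sum_(0 <= m < N) w_ m * y m w.
have w0 m : 0 <= w_ m by rewrite /w_; case: ifP => // _; rewrite divr_ge0 ?ltW.
have y0 m w : 0 <= y m w by rewrite mulr_ge0 ?sqr_ge0 // ltW.
have my m : measurable_fun setT (y m).
  by apply: measurable_funM => //; apply: measurable_funX; exact: measurable_eta.
have mg N : measurable_fun setT (g N).
  by apply: measurable_sum => m; exact: measurable_funM.
have g_nd w m n : (m <= n)%N -> g m w <= g n w.
  move=> mn; rewrite /g (big_cat_nat (leq0n m) mn) //= lerDl.
  by apply: sumr_ge0 => i _; rewrite mulr_ge0.
have gE N w : g N w = s / tau * \sum_(0 <= m < N) ip (u m)
    (X w - spectral_projection ip u k (X w)) ^+ 2.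
  rewrite mulr_sumr; apply: eq_bigr => m _; rewrite (ip_sub_spectral_projection hip) //.
  rewrite /w_ /y; case: ltnP => _; first by rewrite expr0n mul0r mulr0.
  rewrite /KL_coefficient (ipC hip (X w)) exprMn exprVn sqr_sqrtr ?(ltW (l0 m)) //.
  by field; rewrite !gt_eqF.
have gi N : (\int[P]_w (expR (g N w))%:E <= 2%:E)%E.
  apply: expR_moment_convex => //; first by rewrite ler1n.
  - rewrite /w_ (sum_nat_if_lt k N (fun m => l m / tau)) -mulr_suml ler_pdivrMr
      // mul1r.
    exact: htau.
  - by move=> m _; exact: expR_eta_sq.
have -> : (\int[P]_w (expR
    (s / tau * `|X w - spectral_projection ip u k (X w)| ^+ 2))%:E =
   limn (fun N => \int[P]_w (expR (g N w))%:E))%E.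
  rewrite -monotone_convergence //.
  - apply: eq_integral => w _; apply/esym/cvg_lim => //.
    apply: cvg_EFin; first by near=> n.
    have hc : g N w @[N --> \oo] -->
        s / tau * `|X w - spectral_projection ip u k (X w)| ^+ 2.
      under eq_fun do rewrite gE.
      by apply: cvgM; [exact: cvg_cst|exact: (parseval hip ou)].
    exact: (cvg_comp _ _ hc (@continuous_expR R _)).
  - by move=> N; apply/measurable_EFinP; exact: measurableT_comp.
  - by move=> w _ m n mn; rewrite lee_fin ler_expR; exact: g_nd.
apply: lime_le; last by near=> N; exact: gi.
apply: ereal_nondecreasing_is_cvgn => m n mn.
apply: ge0_le_integral_EFin; try exact: measurableT_comp.
- by move=> w; exact: expR_ge0.
- by move=> w; rewrite ler_expR; exact: g_nd.
Unshelve. all: by end_near. Qed.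

End subgaussian_design.

(** * The good event *)

Section sample_design.
Context (R : realType) (H : completeNormedModType R) (ip : H -> H -> R).
Hypothesis hip : is_inner_product ip.
Context d0 (T : measurableType d0) (P0 : probability T R) (X : {RV P0 >-> borel_of H}).
Variables (Sigma : H -> H) (l : nat -> R) (u : nat -> H) (L : R).
Hypothesis L0 : 0 < L.
Hypothesis cX : centered ip P0 X.
Hypothesis cov : is_covariance ip P0 X Sigma.
Hypothesis sd : spectral_decomposition ip Sigma l u.
Hypothesis l0 : forall j, 0 < l j.
Hypothesis ind : independent_family P0 (KL_coefficient ip X l u).
Hypothesis hpsi : (ereal_sup
    [set psi2_norm P0 (KL_coefficient ip X l u j) | j in setT] <= L%:E)%E.
Context d (Omega : measurableType d) (P : probability Omega R) (n : nat).
Variable Xs : 'I_n -> {RV P >-> borel_of H}.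
Hypothesis iid : independent_family P (fun i : 'I_n => Xs i : Omega -> borel_of H).
Hypothesis same : forall i, same_distribution P P0 (Xs i) X.
Hypothesis n1 : (1 <= n)%N.

Let s : R := (4 * expR 1 * L ^+ 2)^-1.
Let s0 : 0 < s.
Proof. by rewrite /s invr_gt0 !mulr_gt0 ?expR_gt0 // exprn_gt0. Qed.
Let n0 : 0 < n%:R :> R. Proof. by rewrite ltr0n. Qed.

(** [KL_coefficient] as a function on [H], to be evaluated at sample points. *)
Definition eta_of (j : nat) (x : H) : R := (Num.sqrt (l j))^-1 * ip x (u j).

Lemma continuous_eta_of j : continuous (eta_of j).
Proof.
move=> x; apply: cvgM; first exact: cvg_cst.
rewrite /= (ipC hip x); under eq_fun do rewrite (ipC hip).
exact: continuous_ipr.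
Qed.

Lemma sample_chernoff (phi : H -> R) (a b : R) : continuous phi ->
  (\int[P0]_w (expR (phi (X w)))%:E <= (expR a)%:E)%E ->
  (P [set w | (n%:R * b <= \sum_i phi (Xs i w))%R] <= (expR (- (n%:R * (b - a))))%:E)%E.
Proof.
move=> cphi ha; have mphi := continuous_borel_measurable cphi.
apply: (chernoff_independent (V := borel_of H) b iid _ mphi) => [i|i].
  exact: measurable_funP.
have := @same_distribution_integral R _ _ _ _ _ (borel_of H) P P0 (Xs i) X (fun x =>
    expR (phi x)).
move=> -> //; exact: measurableT_comp.
Qed.

Lemma measurable_sample_event (phi : H -> R) (c : R) : continuous phi ->
  measurable [set w | c <= \sum_i phi (Xs i w)].
Proof.
move=> cphi; rewrite -[X in measurable X]setTI; apply: measurable_fun_le => //.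
apply: measurable_sum => i.
apply: (measurableT_comp (continuous_borel_measurable cphi)).
exact: measurable_funP.
Qed.

(** The expectation of the sum over the sample is [n * \sum_j v j ^+ 2]. *)
Definition direction_event (k : nat) (v : 'I_k -> R) : set Omega :=
  [set w | n%:R / 2 * \sum_j v j ^+ 2 >=
      \sum_i (\sum_(j < k) eta_of j (Xs i w) * v j) ^+ 2].

Let rate : R := s ^+ 2 / (16 * 192 * expR 1).

Lemma continuous_direction (k : nat) (v : 'I_k -> R) (c : R) :
  continuous (fun x => c * (\sum_(j < k) eta_of j x * v j) ^+ 2).
Proof.
move=> x; apply: cvgM; first exact: cvg_cst.
have h : (fun y => \sum_(j < k) eta_of j y * v j) y @[y --> x] -->
    \sum_(j < k) eta_of j x * v j.
  apply: cvg_big => [|j _]; first exact: add_continuous.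
  by apply: cvgM; [exact: continuous_eta_of|exact: cvg_cst].
by rewrite expr2; under eq_fun do rewrite expr2; exact: cvgM.
Qed.

Lemma direction_eventE (k : nat) (v : 'I_k -> R) (r : R) : 0 < r ->
  direction_event v = [set w | n%:R * (- r / 2 * \sum_j v j ^+ 2) <=
     \sum_i (- r * (\sum_(j < k) eta_of j (Xs i w) * v j) ^+ 2)].
Proof.
move=> r0; have h w : (n%:R * (- r / 2 * \sum_j v j ^+ 2) <=
     \sum_i (- r * (\sum_(j < k) eta_of j (Xs i w) * v j) ^+ 2)) =
   (\sum_i (\sum_(j < k) eta_of j (Xs i w) * v j) ^+ 2 <= n%:R / 2 * \sum_j v j ^+ 2).
  rewrite -mulr_sumr.
  have -> : n%:R * (- r / 2 * \sum_j v j ^+ 2) =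
      - r * (n%:R / 2 * \sum_j v j ^+ 2) by field.
  by rewrite ler_nM2l // oppr_lt0.
by apply/seteqP; split => w; rewrite /direction_event /= h.
Qed.

Lemma measurable_direction_event (k : nat) (v : 'I_k -> R) : measurable
    (direction_event v).
Proof.
rewrite (direction_eventE v ltr01).
apply: (measurable_sample_event (phi := fun x =>
    - 1 * (\sum_(j < k) eta_of j x * v j) ^+ 2)).
exact: continuous_direction.
Qed.

(** The normalized form has mean one, and its exponential moment at [- r]
    is at most [exp (- r + r^2 M)] with [M = 192 e / s^2]; deviating to [1/2]
    costs [r / 2 - r^2 M], which is largest, [1 / (16 M)], at [r = 1 / (4 M)]. *)
Lemma direction_event_le (k : nat) (v : 'I_k -> R) : 0 < \sum_j v j ^+ 2 ->
  (P (direction_event v) <= (expR (- (n%:R * rate)))%:E)%E.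
Proof.
set q := \sum_j _ => q0.
pose M := 192 * expR 1 / s ^+ 2.
have e0 := expR_gt0 (1 : R).
have M0 : 0 < M by rewrite /M divr_gt0 ?mulr_gt0 // exprn_gt0.
pose r := (4 * M)^-1.
have r0 : 0 < r by rewrite /r invr_gt0 mulr_gt0.
have rq : 0 < r / q by rewrite divr_gt0.
pose vn j := if insub j is Some i then v i / Num.sqrt q else 0.
have vnE (i : 'I_k) : vn i = v i / Num.sqrt q by rewrite /vn valK.
have vn1 : \sum_(j < k) vn j ^+ 2 = 1.
  under eq_bigr do rewrite vnE expr_div_n sqr_sqrtr ?(ltW q0) //.
  by rewrite -mulr_suml divff // gt_eqF.
rewrite (direction_eventE v rq) -/q.
have -> : - (r / q) / 2 * q = - r / 2 by field; rewrite gt_eqF.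
have := @sample_chernoff (fun x => - (r / q) * (\sum_(j < k) eta_of j x * v j) ^+ 2)
    (- r + r ^+ 2 * M) (- r / 2).
move=> h; apply: le_trans (h _ _) _.
- exact: continuous_direction.
- have := expR_direction_sq hip L0 cX cov sd l0 ind hpsi vn1 (ltW r0); rewrite -/s -/M.
  apply: le_trans; rewrite le_eqVlt; apply/orP; left; apply/eqP; apply: eq_integral =>
      w _.
  congr (expR _)%:E.
  have -> : \sum_(j < k) vn j * KL_coefficient ip X l u j w =
      (Num.sqrt q)^-1 * \sum_(j < k) eta_of j (X w) * v j.
    rewrite mulr_sumr; apply: eq_bigr => j _; rewrite vnE /eta_of /KL_coefficient; ring.
  by rewrite exprMn exprVn sqr_sqrtr ?(ltW q0) //; ring.
- rewrite lee_fin ler_expR lerN2 ler_pM2l // le_eqVlt; apply/orP; left; apply/eqP.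
  by rewrite /rate /r /M; field; rewrite !gt_eqF.
Qed.

(** The sample is good if its residual energy and the trace of its first [k]
    normalized coordinates are of the expected order and no small grid point
    lies in a bad direction; rounding then controls all directions.  The number
    of grid points is exponential in [k], whence the exponent of the last term. *)
Lemma good_sample (k : nat) (tau : R) : (0 < k)%N -> 0 < tau ->
  (forall N, \sum_(k <= j < N) l j <= tau) ->
  exists A : set Omega, [/\ measurable A,
    ((1 - (2 * expR (- n%:R) +
        expR (- (n%:R * rate) + (4 / Num.min (s / 2) 1 + 2) * k%:R)))%:E <= P A)%E,
    (forall w, A w -> \sum_i `|(Xs i w : H) - spectral_projection ip u k (Xs i w : H)|
        ^+ 2
        <= 2 * n%:R * tau / s) &
    (forall w, A w -> forall v : 'I_k -> R, 4^-1 * \sum_j v j ^+ 2 <=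
       n%:R^-1 * \sum_i (\sum_(j < k) (Num.sqrt (l j))^-1 * ip (Xs i w) (u j) * v j)
           ^+ 2)].
Proof.
move=> k0 tau0 htau.
have k0' : 0 < k%:R :> R by rewrite ltr0n.
(* The mesh satisfies del^2 = th / k.  Rounded unit vectors stay in the ball of
   radius 2 since th <= 1, and rounding costs at most n / 4 since th <= s / 2. *)
set th := Num.min (s / 2) 1.
have th0 : 0 < th by rewrite /th lt_min ltr01 andbT divr_gt0.
have th1 : th <= 1 by rewrite /th ge_min lexx orbT.
have ths : th <= s / 2 by rewrite /th ge_min lexx.
pose del := Num.sqrt (th / k%:R).
have del2 : del ^+ 2 = th / k%:R by rewrite sqr_sqrtr // ltW // divr_gt0.
have del0 : 0 < del by rewrite sqrtr_gt0 divr_gt0.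
pose t0 := 4 / th.
pose M := Num.bound (t0 * k%:R).
pose G := {ffun 'I_k -> bool * 'I_M.+1}.
pose vf (f : G) (j : 'I_k) : R := del * (signed_nat (f j))%:~R.
pose nz (f : G) : R := \sum_j (signed_nat (f j))%:~R ^+ 2.
have vf2 f : \sum_j vf f j ^+ 2 = del ^+ 2 * nz f.
  by rewrite /nz mulr_sumr; apply: eq_bigr => j _; rewrite exprMn.
pose E (f : G) := if (0 < nz f <= t0 * k%:R) then direction_event (vf f) else set0.
have mE f : measurable (E f).
  by rewrite /E; case: ifP => // _; exact: measurable_direction_event.
(* In the ball, exp (t0 k - nz f) >= 1; this factor makes the sum over the grid
   bounded independently of M. *)
have PE f : (P (E f) <= (expR (- (n%:R * rate) + t0 * k%:R) * expR (- nz f))%:E)%E.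
  rewrite /E; case: ifPn => [/andP[nz0 nzk]|_]; last first.
    by rewrite measure0 lee_fin mulr_ge0 ?expR_ge0.
  apply: le_trans (direction_event_le _) _.
    by rewrite vf2 mulr_gt0 // exprn_gt0.
  by rewrite lee_fin -expRD ler_expR; lra.
pose phi1 (x : H) := s / tau * `|x - spectral_projection ip u k x| ^+ 2.
pose phi2 (x : H) := s / k%:R * \sum_(j < k) eta_of j x ^+ 2.
have c1 : continuous phi1.
  move=> x; apply: cvgM; first exact: cvg_cst.
  have h : `|y - spectral_projection ip u k y| @[y --> x] -->
      `|x - spectral_projection ip u k x|.
    apply: cvg_norm; apply: cvgB; first exact: cvg_id.
    exact: continuous_spectral_projection.
  by rewrite expr2; under eq_fun do rewrite expr2; exact: cvgM.
have c2 : continuous phi2.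
  move=> x; apply: cvgM; first exact: cvg_cst.
  apply: cvg_big => [|j _]; first exact: add_continuous.
  have h := @continuous_eta_of j x.
  by rewrite expr2; under eq_fun do rewrite expr2; exact: cvgM.
pose E1 := [set w | n%:R * 2 <= \sum_i phi1 (Xs i w)].
pose E2 := [set w | n%:R * 2 <= \sum_i phi2 (Xs i w)].
have m1 : measurable E1 by exact: measurable_sample_event.
have m2 : measurable E2 by exact: measurable_sample_event.
have n21 : - (n%:R * (2 - 1)) = - n%:R :> R by ring.
have P1 : (P E1 <= (expR (- n%:R))%:E)%E.
  rewrite -n21; apply: sample_chernoff => //.
  exact: (expR_tail hip L0 sd l0 hpsi tau0 htau).
have P2 : (P E2 <= (expR (- n%:R))%:E)%E.
  rewrite -n21; apply: sample_chernoff => //.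
  exact: (expR_head hip L0 hpsi k0).
pose U := \big[setU/set0]_(f : G) E f.
have mU : measurable U by exact: bigsetU_measurable.
have PU : (P U <= (expR (- (n%:R * rate) + (t0 + 2) * k%:R))%:E)%E.
  apply: le_trans (probability_bigsetU_le _ _ mE) _.
  apply: (@le_trans _ _ (\sum_(f : G) (expR (- (n%:R * rate) +
      t0 * k%:R) * expR (- nz f))%:E)%E).
    by apply: lee_sum => f _; exact: PE.
  rewrite sumEFin lee_fin -mulr_sumr.
  have -> : - (n%:R * rate) + (t0 + 2) * k%:R = (- (n%:R * rate) + t0 * k%:R) +
      2 * k%:R by ring.
  by rewrite [leRHS]expRD ler_pM2l ?expR_gt0 // grid_weight.
pose Bad := E1 `|` E2 `|` U.
have mBad : measurable Bad by do 2 apply: measurableU => //.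
have PBad : (P Bad <= (2 * expR (- n%:R) +
    expR (- (n%:R * rate) + (t0 + 2) * k%:R))%:E)%E.
  rewrite EFinD; apply: (@le_trans _ _ (P (E1 `|` E2) + P U)%E).
    by apply: measureU2 => //; exact: measurableU.
  apply: leeD => //; apply: (@le_trans _ _ (P E1 + P E2)%E).
    exact: measureU2.
  by rewrite mulrDl mul1r EFinD leeD.
exists (~` Bad); split.
- exact: measurableC.
- rewrite probability_setC // EFinB; exact: leeB.
- move=> w nB.
  have : ~ E1 w by move=> h; apply: nB; left; left.
  move=> /negP; rewrite -ltNge /phi1 -mulr_sumr => h.
  rewrite ler_pdivlMr // mulrC -ler_pdivrMr //.
  by rewrite mulrAC mulrC; apply: ltW; rewrite mulrC [n%:R * 2]mulrC in h *.
- move=> w nB.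
  have hE2 : \sum_j \sum_i eta_of (j : 'I_k) (Xs i w) ^+ 2 <= 2 * n%:R * k%:R / s.
    have : ~ E2 w by move=> h; apply: nB; left; right.
    move=> /negP; rewrite -ltNge /phi2 -mulr_sumr exchange_big /= => h.
    rewrite ler_pdivlMr // mulrC -ler_pdivrMr //.
    by rewrite mulrAC; apply: ltW; rewrite [n%:R * 2]mulrC in h.
  have unit (v : 'I_k -> R) : \sum_j v j ^+ 2 = 1 ->
      n%:R / 4 <= \sum_i (\sum_(j < k) eta_of j (Xs i w) * v j) ^+ 2.
    move=> v1; apply: le_trans (@quadratic_form_rounding R 'I_n k (fun i j =>
        eta_of j (Xs i w))
      (n%:R / 2) del _ del0 _ _ v v1); first last.
    + move=> z z4.
      have zn : \sum_j (z j)%:~R ^+ 2 <= t0 * k%:R :> R.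
        have e : \sum_j (del * (z j)%:~R) ^+ 2 = th / k%:R * \sum_j (z j)%:~R ^+ 2.
          by rewrite mulr_sumr; apply: eq_bigr => j _; rewrite exprMn del2.
        rewrite e in z4; rewrite /t0 mulrAC ler_pdivlMr // mulrC.
        by rewrite mulrAC ler_pdivrMr // in z4.
      have zM j : (`|z j| <= M)%N.
        apply: ltnW; rewrite -(ltr_nat R).
        have t0k : 0 <= t0 * k%:R by rewrite mulr_ge0 // divr_ge0 // ltW.
        apply: le_lt_trans (archi_boundP t0k).
        apply: le_trans zn; rewrite (bigD1 j) //=.
        apply: le_trans (absz_le_sqr R (z j)) _.
        by rewrite lerDl sumr_ge0 // => i _; exact: sqr_ge0.
      have /choice[p pE] : forall j, exists p, signed_nat (M := M) p = z j.
        by move=> j; exact: signed_natP.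
      pose f : G := [ffun j => p j].
      have fE j : signed_nat (f j) = z j by rewrite ffunE pE.
      have vE j : del * (z j)%:~R = vf f j by rewrite /vf fE.
      have nzE : nz f = \sum_j (z j)%:~R ^+ 2 by apply: eq_bigr => j _; rewrite fE.
      under eq_bigr do rewrite vE.
      under [leRHS]eq_bigr do under eq_bigr do rewrite vE.
      have nz0 : 0 <= nz f by apply: sumr_ge0 => j _; exact: sqr_ge0.
      move: nz0; rewrite le_eqVlt => /predU1P[nz0|nz0].
        by rewrite vf2 -nz0 !mulr0; apply: sumr_ge0 => i _; exact: sqr_ge0.
      have : ~ E f w.
        by move=> h; apply: nB; right; rewrite /U (bigD1 f) //=; left.
      rewrite /E nz0 nzE zn /= => /negP; rewrite -ltNge; exact: ltW.
    + by rewrite del2 mulrCA divff ?mulr1 // gt_eqF.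
    + by rewrite divr_ge0 // ltW.
    + apply: (@le_trans _ _ (n%:R / 2 - del ^+ 2 / 4 * (2 * n%:R * k%:R / s)));
        last first.
        by rewrite lerD2l lerN2 ler_wpM2l // divr_ge0 // sqr_ge0.
      have -> : del ^+ 2 / 4 * (2 * n%:R * k%:R / s) = th / s * n%:R / 2.
        by rewrite del2; field; rewrite !gt_eqF.
      have hx : th / s <= 1 / 2 by rewrite ler_pdivrMr //; lra.
      have := ler_wpM2r (ltW n0) hx; lra.
  move=> v; set q := \sum_j _.
  have q0 : 0 <= q by apply: sumr_ge0 => j _; exact: sqr_ge0.
  move: q0; rewrite le_eqVlt => /predU1P[<-|q0].
    by rewrite mulr0 mulr_ge0 ?invr_ge0 ?(ltW n0) // sumr_ge0 // => i _; exact: sqr_ge0.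
  have := unit (fun j => v j / Num.sqrt q).
  have -> : \sum_j (v j / Num.sqrt q) ^+ 2 = 1.
    under eq_bigr do rewrite expr_div_n sqr_sqrtr ?(ltW q0) //.
    by rewrite -mulr_suml divff // gt_eqF.
  move=> /(_ erefl).
  have -> : \sum_i (\sum_(j < k) eta_of j (Xs i w) * (v j / Num.sqrt q)) ^+ 2 =
     q^-1 * \sum_i (\sum_(j < k) (Num.sqrt (l j))^-1 * ip (Xs i w) (u j) * v j) ^+ 2.
    rewrite mulr_sumr; apply: eq_bigr => i _.
    have -> : \sum_(j < k) eta_of j (Xs i w) * (v j / Num.sqrt q) =
      (Num.sqrt q)^-1 * \sum_(j < k) (Num.sqrt (l j))^-1 * ip (Xs i w) (u j) * v j.
      by rewrite mulr_sumr; apply: eq_bigr => j _; rewrite /eta_of; ring.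
    by rewrite exprMn exprVn sqr_sqrtr // ltW.
  set S := \sum_i _ => h.
  rewrite [leRHS]mulrC ler_pdivlMr //.
  move: h; rewrite [leRHS]mulrC ler_pdivlMr //; lra.
Qed.

End sample_design.

(** * The bound for the empirical projection *)

Theorem corollary4 (R : realType) (L alpha K beta : R) :
  0 < L -> 0 < alpha -> 0 < K -> 0 < beta <= 1 ->
  exists c1 c2 C1 C2 : R, [/\ 0 < c1, 0 < c2, 0 < C1 & 0 < C2] /\
  forall (H : completeNormedModType R) (ip : H -> H -> R),
  is_inner_product ip ->
  forall (d0 : measure_display) (Omega0 : measurableType d0)
    (P0 : probability Omega0 R) (X : {RV P0 >-> borel_of H})
    (Sigma : H -> H) (lambda : nat -> R) (u : nat -> H),
  centered ip P0 X ->
  strongly_square_integrable P0 X ->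
  is_covariance ip P0 X Sigma ->
  spectral_decomposition ip Sigma lambda u ->
  (forall j, 0 < lambda j) ->
  independent_family P0 (KL_coefficient ip X lambda u) ->
  (ereal_sup [set psi2_norm P0 (KL_coefficient ip X lambda u j) | j in setT]
     <= L%:E)%E ->
  (forall j : nat, K^-1 * expR (- alpha * j.+1%:R `^ beta) <= lambda j
                   <= K * expR (- alpha * j.+1%:R `^ beta)) ->
  forall (n : nat) (d : measure_display) (Omega : measurableType d)
    (P : probability Omega R) (Xs : 'I_n -> {RV P >-> borel_of H})
    (hlambda : Omega -> nat -> R) (hu : Omega -> nat -> H),
  (1 <= n)%N ->
  independent_family P (fun i : 'I_n => Xs i : Omega -> borel_of H) ->
  (forall i, same_distribution P P0 (Xs i) X) ->
  (forall w, spectral_decomposition ip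
     (sample_covariance ip (fun i : 'I_n => Xs i w : H))
     (hlambda w) (hu w)) ->
  forall k : nat, (1 <= k)%N -> k%:R <= c1 * n%:R ->
  let B := C1 * k%:R `^ (1 - beta) * expR (- alpha * k.+1%:R `^ beta) in
  exists minR : \bar R,
    is_minimum [set reconstruction_error P0 X Q
               | Q in orthogonal_projections ip k] minR /\
    with_probability_at_least P (1 - expR (- c2 * n%:R))
      [set w | (reconstruction_error P0 X (spectral_projection ip (hu w) k)
                  <= B%:E)%E /\ (B%:E <= C2%:E * minR)%E].
Proof.
move=> L0 a0 K0 /[dup] b01 /andP[b0 b1].
have [Ct Ct0 hCt] := stretched_exp_tail_le a0 b01.
pose s : R := (4 * expR 1 * L ^+ 2)^-1.
have s0 : 0 < s by rewrite /s invr_gt0 !mulr_gt0 ?expR_gt0 // exprn_gt0.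
pose rate : R := s ^+ 2 / (16 * 192 * expR 1).
have rate0 : 0 < rate by rewrite /rate divr_gt0 ?exprn_gt0 ?mulr_gt0 ?expR_gt0.
pose kap : R := 4 / Num.min (s / 2) 1 + 2.
have kap0 : 0 < kap.
  by rewrite /kap addr_gt0 // divr_gt0 // lt_min ltr01 andbT divr_gt0.
pose c' : R := Num.min (rate / 2) 1.
have c'0 : 0 < c' by rewrite /c' lt_min ltr01 andbT divr_gt0.
have c'r : c' <= rate / 2 by rewrite /c' ge_min lexx.
have c'1 : c' <= 1 by rewrite /c' ge_min lexx orbT.
(* c1 * kap <= rate / 2 absorbs the number of grid points; c1 <= c' / 4 forces
   c' * n >= 4 because k >= 1, which absorbs the factor 3 of the union bound. *)
pose c1 : R := Num.min (rate / (2 * kap)) (c' / 4).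
have r2 : 0 < rate / (2 * kap) by apply: divr_gt0 => //; apply: mulr_gt0.
have c4 : 0 < c' / 4 by apply: divr_gt0.
have c10 : 0 < c1 by rewrite /c1 lt_min r2 c4.
have c1r : c1 * kap <= rate / 2.
  have : c1 <= rate / (2 * kap) by rewrite /c1 ge_min lexx.
  by rewrite invfM mulrA ler_pdivlMr.
have c1c : c1 <= c' / 4 by rewrite /c1 ge_min lexx orbT.
(* The risk is at most 2 tau + 2 (32 tau / s), where tau = K Ct k^(1 - beta)
   exp (- alpha (k + 1)^beta) bounds the tail of the eigenvalues. *)
pose C1 : R := (2 + 64 / s) * (K * Ct).
have KC0 : 0 < K * Ct by apply: mulr_gt0.
have s64 : 0 < 64 / s by apply: divr_gt0.
have C10 : 0 < C1 by apply: mulr_gt0 => //; apply: addr_gt0.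
exists c1, (c' / 2), C1, (C1 * K * expR alpha); split.
  split => //; first exact: divr_gt0.
  by apply: mulr_gt0; [exact: mulr_gt0 | exact: expR_gt0].
move=> H ip hip d0 Omega0 P0 X Sigma l u cX ssi cov sd l0 ind hpsi lexp
  n d Omega P Xs hl hu n1 iid same hsd k k1 kn.
have [_ ou _] := sd.
have n0 : 0 < n%:R :> R by rewrite ltr0n.
set e := expR (- alpha * k.+1%:R `^ beta).
set p := k%:R `^ (1 - beta).
have e0 : 0 < e by exact: expR_gt0.
have p0 : 0 < p by rewrite powR_gt0 // ltr0n.
move=> B.
pose tau := K * Ct * p * e.
have tau0 : 0 < tau by rewrite /tau !mulr_gt0.
have htau N : \sum_(k <= j < N) l j <= tau.
  apply: (@le_trans _ _ (K * \sum_(k <= j < N) expR (- alpha * j.+1%:R `^ beta))).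
    by rewrite mulr_sumr; apply: ler_sum => j _; have /andP[] := lexp j.
  by rewrite /tau -!mulrA ler_pM2l // mulrA; exact: hCt.
exists (reconstruction_error P0 X (spectral_projection ip u k)); split.
  exact: (risk_minimizer hip cov sd l0).
have [A [mA PA A1 A2]] := good_sample hip L0 cX cov sd l0 ind hpsi iid same n1 k1 tau0
    htau.
exists A; split => //; last first.
  apply: le_trans PA; rewrite lee_fin lerD2l lerN2.
  rewrite -/s -/rate -/kap.
  have k1' : 1 <= k%:R :> R by rewrite ler1n.
  have cn : 4 <= c' * n%:R.
    have := le_trans k1' kn; have := ler_wpM2r (ltW n0) c1c; lra.
  have h1 : expR (- n%:R) <= expR (- (c' * n%:R)) :> R.
    by rewrite ler_expR lerN2 ger_pMl.
  have h2 : expR (- (n%:R * rate) + kap * k%:R) <= expR (- (c' * n%:R)).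
    rewrite ler_expR.
    have h3 : kap * k%:R <= rate / 2 * n%:R.
      apply: (@le_trans _ _ (kap * (c1 * n%:R))); first by rewrite ler_pM2l.
      by rewrite mulrA [kap * _]mulrC ler_pM2r.
    have := ler_wpM2r (ltW n0) c'r; lra.
  apply: (@le_trans _ _ (3 * expR (- (c' * n%:R)))); first by lra.
  have -> : - (c' * n%:R) = - (c' * n%:R / 2) + - (c' / 2) * n%:R by field.
  rewrite expRD mulrA -[leRHS]mul1r ler_pM2r ?expR_gt0 // expRN.
  rewrite ler_pdivrMr ?expR_gt0 // mul1r.
  apply: le_trans (expR_ge1Dx _); lra.
move=> w Aw; split; last first.
  have [N hN] := stretched_exp_tail_ge a0 b01 k1.
  apply: (@le_trans _ _ ((C1 * K * expR alpha)%:E * (\sum_(k <= j < N) l j)%:E)%E);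
      last first.
    rewrite lee_wpmul2l ?lee_fin ?(risk_tail_ge hip cov sd) //.
    by apply: mulr_ge0; [apply: mulr_ge0; exact: ltW | exact: expR_ge0].
  rewrite -EFinM lee_fin /B.
  have h : K^-1 * (expR (- alpha) * p * e) <= \sum_(k <= j < N) l j.
    apply: (@le_trans _ _ (K^-1 * \sum_(k <= j < N) expR (- alpha * j.+1%:R `^ beta))).
      by rewrite ler_pM2l ?invr_gt0.
    by rewrite mulr_sumr; apply: ler_sum => j _; have /andP[] := lexp j.
  apply: (@le_trans _ _ (C1 * K * expR alpha * (K^-1 * (expR (- alpha) * p * e))));
      last first.
    rewrite ler_pM2l //; apply: mulr_gt0; last exact: expR_gt0.
    exact: mulr_gt0.
  rewrite expRN le_eqVlt; apply/orP; left; apply/eqP; field.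
  by rewrite !gt_eqF // expR_gt0.
have [_ ohu _] := hsd w.
have c40 : 0 < 4^-1 :> R by rewrite invr_gt0.
have ex := excess_risk_le hip n1 (hsd w) ou c40 l0 (A2 w Aw).
have hB N : \sum_(k <= m < N) \sum_(j < k) l j * ip (u j) (hu w m) ^+ 2 <= 32 * tau / s.
  apply: le_trans (ex N) _.
  apply: (@le_trans _ _ (4 / (4^-1 * n%:R) * (2 * n%:R * tau / s))).
    by rewrite ler_pM2l ?A1 // divr_gt0 // mulr_gt0.
  rewrite le_eqVlt; apply/orP; left; apply/eqP; field.
  by rewrite !gt_eqF.
apply: le_trans (risk_le_excess hip cov sd ohu hB) _.
apply: (@le_trans _ _ (2%:E * tau%:E + (2 * (32 * tau / s))%:E)%E).
  by rewrite leeD2r // lee_wpmul2l // (risk_tail_le hip cov sd htau).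
rewrite -EFinM -EFinD lee_fin /B /C1 /tau -/p -/e le_eqVlt; apply/orP; left; apply/eqP.
by field; rewrite gt_eqF.
Qed.
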